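(* Let $F$ and $\overline F$ be two projectively related Finsler metrics on a connected smooth manifold $M$ of dimension at least $2$, with geodesic sprays $S$ and $\overline S=S-2P\mathcal C$. If $F$ is of constant flag curvature and the projective factor $P$ is a Hamel function (i.e. $\delta_SP=0$), then $\overline F$ is of constant flag curvature.
   Context: $T_0M$ is the tangent bundle with zero section removed, with induced coordinates $(x^i,y^i)$; $\mathcal C=y^i\frac{\partial}{\partial y^i}$, $J=dx^i\otimes\frac{\partial}{\partial y^i}$, and $d_Jf=\frac{\partial f}{\partial y^i}dx^i$ for functions $f$ on $T_0M$. A Finsler function (metric) is a continuous $F:TM\to\mathbb R$, smooth and strictly positive on $T_0M$, with $F(x,\lambda y)=\lambda F(x,y)$ for $\lambda>0$, and such that $g_{ij}=\frac12\frac{\partial^2F^2}{\partial y^i\partial y^j}$ has rank $n=\dim M$ on $T_0M$. Its geodesic spray is the unique vector field $S=y^i\frac{\partial}{\partial x^i}-2G^i(x,y)\frac{\partial}{\partial y^i}$ on $T_0M$ with $i_S\,dd_JF^2=-dF^2$. Two Finsler metrics are projectively related if their geodesic sprays satisfy $\overline S=S-2P\mathcal C$ for some $1$-homogeneous $P\in C^\infty(T_0M)$ (i.e. $\mathcal C(P)=P$), called the projective factor. Put $N^i_j=\partial G^i/\partial y^j$, $\frac{\delta}{\delta x^i}=\frac{\partial}{\partial x^i}-N^j_i\frac{\partial}{\partial y^j}$. The Jacobi endomorphism of $S$ is $\Phi=R^i_j\,\frac{\partial}{\partial y^i}\otimes dx^j$ with $R^i_j=2\frac{\delta G^i}{\delta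 x^j}-S(N^i_j)+N^i_kN^k_j$. $F$ has constant flag curvature if there is a constant $\kappa$ with $\Phi=\kappa F^2J-\kappa F\,d_JF\otimes\mathcal C$. The Euler–Lagrange 1-form of a function $L$ is $\delta_SL=\left\{S\left(\frac{\partial L}{\partial y^i}\right)-\frac{\partial L}{\partial x^i}\right\}dx^i$; a $1$-homogeneous function $L$ with $\delta_SL=0$ is called a Hamel function. *)

(* Defs.v *)
From HB Require Import structures.
From mathcomp Require Import all_boot all_order all_algebra.
From mathcomp Require Import all_classical all_reals all_analysis.
Set Implicit Arguments.
Unset Strict Implicit.
Unset Printing Implicit Defensive.
Import Order.TTheory GRing.Theory Num.Theory.
Import numFieldNormedType.Exports.
Local Open Scope classical_set_scope.
Local Open Scope ring_scope.

(* C^k and C^oo on an open set [A] of a finite-dimensional normed space: being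
   C^(k+1) means being differentiable with all directional derivatives C^k. *)
Fixpoint Ck_on (R : realType) (V W : normedModType R) (A : set V) (k : nat)
    (f : V -> W) : Prop :=
  match k with
  | 0 => forall x, A x -> {for x, continuous f}
  | k'.+1 => (forall x, A x -> differentiable f x) /\
             (forall v : V, Ck_on A k' ('D_v f))
  end.

Definition smooth_on (R : realType) (V W : normedModType R) (A : set V)
  (f : V -> W) : Prop := forall k, Ck_on A k f.

(* The two maps are total; they are meaningful only on [cdom] and [ccod]. *)
Record chart (R : realType) (n : nat) (M : topologicalType) := Chart {
  cdom : set M ;
  ccod : set 'rV[R]_n ;
  cmap : M -> 'rV[R]_n ;
  cinv : 'rV[R]_n -> M ;
  open_cdom : open cdom ;
  open_ccod : open ccod ;
  cmap_ccod : forall p, cdom p -> ccod (cmap p) ;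
  cinv_cdom : forall x, ccod x -> cdom (cinv x) ;
  cmapK : forall p, cdom p -> cinv (cmap p) = p ;
  cinvK : forall x, ccod x -> cmap (cinv x) = x ;
  cmap_continuous : forall p, cdom p -> {for p, continuous cmap} ;
  cinv_continuous : forall x, ccod x -> {for x, continuous cinv}
}.

Definition chart_trans (R : realType) (n : nat) (M : topologicalType)
  (c c' : chart R n M) : 'rV[R]_n -> 'rV[R]_n := cmap c' \o cinv c.

Record smooth_manifold (R : realType) (n : nat) := SmoothManifold {
  mcarrier :> topologicalType ;
  mhausdorff : hausdorff_space mcarrier ;
  msecond_countable : @second_countable mcarrier ;
  midx : Type ;
  mchart : midx -> chart R n mcarrier ;
  mchart_cover : forall p, exists c, cdom (mchart c) p ;
  mchart_smooth : forall c c',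
    smooth_on (ccod (mchart c) `&` cinv (mchart c) @^-1` cdom (mchart c'))
              (chart_trans (mchart c) (mchart c'))
}.

Section TangentBundle.
Context (R : realType) (n : nat) (M : smooth_manifold R n).
Local Notation E := ('rV[R]_n * 'rV[R]_n)%type.
Local Notation ch := (@mchart R n M).

(* A point of TM is a point of M together with one component vector for each
   chart around that point, these being related by the Jacobians of the changes
   of charts.  Components in charts that miss the point are set to 0, so that
   equality of tangent vectors is Leibniz equality. *)
Record tangent_bundle := TangentVector {
  tpoint : M ;
  tcomp : midx M -> 'rV[R]_n ;
  tcomp_out : forall c, ~ cdom (ch c) tpoint -> tcomp c = 0 ;
  tcomp_trans : forall c c', cdom (ch c) tpoint -> cdom (ch c') tpoint ->
    tcomp c' = 'D_(tcomp c) (chart_trans (ch c) (ch c')) (cmap (ch c) tpoint)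
}.

Lemma tangent_bundle_eq (t u : tangent_bundle) :
  tpoint t = tpoint u -> tcomp t = tcomp u -> t = u.
Proof.
case: t u => [p v o h] [q w o' h'] /= pq vw; subst q w.
by congr TangentVector; exact: Prop_irrelevance.
Qed.

Lemma near_chart_trans (c c' : midx M) x :
  ccod (ch c) x -> cdom (ch c') (cinv (ch c) x) ->
  \forall y \near x, ccod (ch c) y /\ cdom (ch c') (cinv (ch c) y).
Proof.
move=> cx c'x; near=> y; split; near: y.
  by apply: open_nbhs_nbhs; split => //; exact: open_ccod.
apply: (cinv_continuous cx); apply: open_nbhs_nbhs; split => //.
exact: open_cdom.
Unshelve. all: by end_near. Qed.

Lemma chart_trans_diff (c c' : midx M) x :
  ccod (ch c) x -> cdom (ch c') (cinv (ch c) x) ->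
  differentiable (chart_trans (ch c) (ch c')) x.
Proof. by move=> cx c'x; have [+ _] := mchart_smooth c c' 1; apply. Qed.

(* The tangent vector with induced coordinates [z] = (x, y) in the chart [c]
   (a zero vector when x lies outside the range of [c]). *)
Definition of_coords_comp (c : midx M) (z : E) (c' : midx M) : 'rV[R]_n :=
  if `[< ccod (ch c) z.1 /\ cdom (ch c') (cinv (ch c) z.1) >]
  then 'D_(z.2) (chart_trans (ch c) (ch c')) z.1 else 0.

Lemma of_coords_out c z c' :
  ~ cdom (ch c') (cinv (ch c) z.1) -> of_coords_comp c z c' = 0.
Proof. by rewrite /of_coords_comp => ?; case: asboolP => // -[]. Qed.

Lemma derive_chart_trans (c c' c'' : midx M) (x y : 'rV[R]_n) :
  ccod (ch c) x ->
  cdom (ch c') (cinv (ch c) x) -> cdom (ch c'') (cinv (ch c) x) ->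
  'D_y (chart_trans (ch c) (ch c'')) x =
  'D_('D_y (chart_trans (ch c) (ch c')) x) (chart_trans (ch c') (ch c''))
    (cmap (ch c') (cinv (ch c) x)).
Proof.
move=> cx h' h''; have D' := chart_trans_diff cx h'.
have D'' : differentiable (chart_trans (ch c') (ch c''))
    (cmap (ch c') (cinv (ch c) x)).
  by apply: chart_trans_diff; rewrite ?cmapK //; exact: cmap_ccod.
transitivity
  ('D_y (chart_trans (ch c') (ch c'') \o chart_trans (ch c) (ch c')) x).
  apply: near_eq_derive; apply: filterS (near_chart_trans cx h') => u [cu c'u].
  by rewrite /chart_trans /= cmapK.
rewrite (deriveE _ (differentiable_comp D' D'')) diff_comp //.
by rewrite (deriveE y D') (deriveE _ D'').
Qed.

Lemma of_coords_trans c z c' c'' :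
  cdom (ch c') (cinv (ch c) z.1) -> cdom (ch c'') (cinv (ch c) z.1) ->
  of_coords_comp c z c'' =
  'D_(of_coords_comp c z c') (chart_trans (ch c') (ch c''))
    (cmap (ch c') (cinv (ch c) z.1)).
Proof.
case: z => x y /= h' h''; rewrite /of_coords_comp /=.
have [cx|ncx] := pselect (ccod (ch c) x).
  by rewrite !asboolT //; exact: derive_chart_trans.
by rewrite !asboolF ?derive0 // => -[].
Qed.

Definition of_coords (c : midx M) (z : E) : tangent_bundle :=
  TangentVector (@of_coords_out c z) (@of_coords_trans c z).

Definition coords (c : midx M) (t : tangent_bundle) : E :=
  (cmap (ch c) (tpoint t), tcomp t c).

Lemma of_coordsK c z : ccod (ch c) z.1 -> coords c (of_coords c z) = z.
Proof.
case: z => x y /= cx; rewrite /coords /= cinvK //; congr pair.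
rewrite /of_coords_comp /=; case: asboolP => [_|[]]; last first.
  by split => //; exact: cinv_cdom.
rewrite (@near_eq_derive _ _ _ _ id); first by rewrite derive_id.
apply: filterS (near_chart_trans cx (cinv_cdom cx)) => u [cu _].
by rewrite /chart_trans /= cinvK.
Qed.

Lemma coordsK c t : cdom (ch c) (tpoint t) -> of_coords c (coords c t) = t.
Proof.
move=> ct; apply: tangent_bundle_eq; rewrite /= ?cmapK //.
apply/funext => c'; rewrite /of_coords_comp /= cmapK //.
case: asboolP => [[_ c't]|nt]; first by rewrite (tcomp_trans ct c't).
rewrite tcomp_out // => c't; apply: nt; split => //; exact: cmap_ccod.
Qed.

(* [Tdom c] and [T0dom c]: ranges of the induced coordinates on TM and T_0M. *)
Definition Tdom (c : midx M) : set E := [set z | ccod (ch c) z.1].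
Definition T0dom (c : midx M) : set E := [set z | ccod (ch c) z.1 /\ z.2 != 0].

Definition tangent_trans (c c' : midx M) : E -> E := coords c' \o of_coords c.

(* Functions on T_0M are represented by functions on TM whose values on the
   zero section are irrelevant. *)
Definition local (f : tangent_bundle -> R) (c : midx M) : E -> R :=
  f \o of_coords c.

Definition smooth_T0 (f : tangent_bundle -> R) : Prop :=
  forall c, smooth_on (T0dom c) (local f c).

Record T0_vector_field := T0VectorField {
  vf_comp :> midx M -> E -> E ;
  vf_smooth : forall c, smooth_on (T0dom c) (vf_comp c) ;
  vf_trans : forall c c' z, T0dom c z -> cdom (ch c') (cinv (ch c) z.1) ->
    vf_comp c' (tangent_trans c c' z) =
    'D_(vf_comp c z) (tangent_trans c c') z
}.

End TangentBundle.

Section LocalCalculus.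
Context (R : realType) (n : nat).
Local Notation E := ('rV[R]_n * 'rV[R]_n)%type.

(* d/dx^i and d/dy^i *)
Definition dx (i : 'I_n) (f : E -> R) : E -> R :=
  'D_((delta_mx 0 i, 0) : E) f.
Definition dy (i : 'I_n) (f : E -> R) : E -> R :=
  'D_((0, delta_mx 0 i) : E) f.

Definition vf_app (X : E -> E) (f : E -> R) : E -> R := fun z => 'D_(X z) f z.

Definition liouville (z : E) : E := (0, z.2).

Definition tangent_structure (v : E) : E := (0, v.1).

(* 1-forms are maps [w : E -> E -> R], [w z v] being the value at [z] on [v]. *)
Definition diff_form (f : E -> R) (z v : E) : R := 'D_v f z.

Definition dJ (f : E -> R) (z v : E) : R := \sum_i dy i f z * v.1 0 i.

(* dw(u, v) = u(w(v)) - v(w(u)) for constant vector fields u and v *)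
Definition ext_deriv (w : E -> E -> R) (z u v : E) : R :=
  'D_u (w^~ v) z - 'D_v (w^~ u) z.

Definition metric_tensor (f : E -> R) (z : E) : 'M[R]_n :=
  \matrix_(i, j) (2^-1 * dy i (dy j (fun w => f w ^+ 2)) z).

Section Spray.
Variable S : E -> E.

(* S = y^i d/dx^i - 2 G^i d/dy^i *)
Definition spray_coef (i : 'I_n) (z : E) : R := - (2^-1 * (S z).2 0 i).

Definition nonlin_conn (i j : 'I_n) : E -> R := dy j (spray_coef i).

Definition horiz (i : 'I_n) (f : E -> R) (z : E) : R :=
  dx i f z - \sum_j nonlin_conn j i z * dy j f z.

Definition jacobi_coef (i j : 'I_n) (z : E) : R :=
  2 * horiz j (spray_coef i) z - vf_app S (nonlin_conn i j) z
  + \sum_k nonlin_conn i k z * nonlin_conn k j z.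

Definition jacobi_endo (z v : E) : E :=
  (0, \row_i \sum_j jacobi_coef i j z * v.1 0 j).

Definition euler_lagrange (f : E -> R) (z v : E) : R :=
  \sum_i (vf_app S (dy i f) z - dx i f z) * v.1 0 i.

End Spray.

End LocalCalculus.

Section Finsler.
Context (R : realType) (n : nat) (M : smooth_manifold R n).
Local Notation TM := (tangent_bundle M).

Definition finsler (F : TM -> R) : Prop :=
  [/\ forall c z, Tdom c z -> {for z, continuous (local F c)},
      smooth_T0 F,
      forall c z, T0dom c z -> 0 < local F c z,
      forall c z (l : R), Tdom c z -> 0 < l ->
        local F c (z.1, l *: z.2) = l * local F c z
    & forall c z, T0dom c z -> \rank (metric_tensor (local F c) z) = n].

(* i_S d d_J F^2 = - d F^2 *)
Definition geodesic_spray (F : TM -> R) (S : T0_vector_field M) : Prop :=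
  forall c z, T0dom c z ->
    (S c z).1 = z.2 /\
    forall v, ext_deriv (dJ (fun w => local F c w ^+ 2)) z (S c z) v =
              - diff_form (fun w => local F c w ^+ 2) z v.

Definition homogeneous1 (f : TM -> R) : Prop :=
  forall c z, T0dom c z -> vf_app (@liouville R n) (local f c) z = local f c z.

Definition projectively_related (S Sbar : T0_vector_field M) (P : TM -> R)
    : Prop :=
  [/\ smooth_T0 P, homogeneous1 P
    & forall c z, T0dom c z ->
        Sbar c z = S c z - (2 * local P c z) *: liouville z].

Definition hamel (S : T0_vector_field M) (L : TM -> R) : Prop :=
  homogeneous1 L /\
  forall c z, T0dom c z -> forall v, euler_lagrange (S c) (local L c) z v = 0.

(* [S] is meant to be the geodesic spray of [F]. *)
Definition constant_flag_curvature (F : TM -> R) (S : T0_vector_field M)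
    : Prop :=
  exists kappa : R, forall c z, T0dom c z -> forall v,
    jacobi_endo (S c) z v =
      (kappa * local F c z ^+ 2) *: tangent_structure v
      - (kappa * local F c z * dJ (local F c) z v) *: liouville z.

End Finsler.

(* Main.v *)
From HB Require Import structures.
Require Import Defs.
From mathcomp Require Import all_boot all_order all_algebra.
From mathcomp Require Import all_classical all_reals all_analysis.
From mathcomp Require Import ring lra.
Import Order.TTheory GRing.Theory Num.Theory.
Import numFieldNormedType.Exports.
Set Implicit Arguments.
Unset Strict Implicit.
Unset Printing Implicit Defensive.
Local Open Scope classical_set_scope.
Local Open Scope ring_scope.

(** Write L = F^2, Q = S(P) and rho = kappa L + P^2 - Q, where kappa is the flag
    curvature of F, and let N and delta/delta x^j be the connection and the
    horizontal derivatives of S.  Two commutators carry the proof: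

      [d/dy^j, S] = 2 delta/delta x^j - d/dx^j,
      [S, delta/delta x^j] = N^k_j delta/delta x^k + R^l_j d/dy^l

    ([dY_spray] and [spray_hor]).  By the first one, a function f with
    delta_S f = 0 satisfies dQ/dy^j = 2 delta f/delta x^j for Q = S(f).  This
    applies to P, which is a Hamel function, and to L, for which S(L) = 0, so
    that L is horizontally constant.

    Expanding the definition of the Jacobi endomorphism along S - 2 P C gives
    Rbar^i_j = R^i_j + (P^2 - Q) delta^i_j + tau_j y^i, and the Hamel equation
    turns tau_j into - 1/2 d(P^2 - Q)/dy^j.  Hence
    Rbar^i_j = rho delta^i_j - 1/2 (drho/dy^j) y^i.  On the other hand the second
    commutator, applied to Lbar = Fbar^2 and Sbar, gives
    Rbar^i_j dLbar/dy^i = 0, and inserting the formula for Rbar shows that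
    u = rho / Lbar has no vertical derivative.  As the fibres of T_0M are
    connected in dimension at least 2, Fbar has a flag curvature u that is a
    function on M.

    Constancy of u cannot come from the Schur lemma alone, which says nothing
    in dimension 2, so the Hamel equation is used once more.  The second
    commutator applied to P gives
    dS(Q)/dy^j = 3 delta Q/delta x^j + 2 kappa L dP/dy^j - kappa P dL/dy^j, and
    this is equivalent to dSbar(rho)/dy^j = 3 deltabar rho/delta x^j.  With
    rho = u Lbar and a = y^i du/dx^i this becomes
    a dLbar/dy^j = 2 Lbar du/dx^j ([constant_curvature_proj]).  As n >= 2, every
    fibre contains a nonzero y with a(y) = 0; since Lbar > 0 all du/dx^j vanish
    there, and they do not depend on y.  So u is locally constant, and it is
    constant because M is connected and u does not depend on the chart, S(P)
    being the derivative of a function along a vector field of T_0M.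

    The identities are polynomial in the derivatives of finitely many smooth
    functions.  They are proved in an arbitrary commutative ring with commuting
    derivations d/dx^i, d/dy^i and elements y^i, and then read in the ring of
    smooth functions on a coordinate domain of T_0M. *)

(** * Mean values and symmetry of second derivatives *)

Section Line.
Context (R : realType) (V : normedModType R).
Implicit Types (f g : V -> R) (a u v z : V).

Lemma is_derive_line f a v (t : R) :
  derivable f (a + t *: v) v ->
  is_derive t 1 (fun s : R => f (a + s *: v)) ('D_v f (a + t *: v)).
Proof.
move=> df.
have E : (fun h : R => h^-1 *: (((fun s : R => f (a + s *: v)) \o shift t) (h *: 1)
    - f (a + t *: v))) =
  (fun h : R => h^-1 *: ((f \o shift (a + t *: v)) (h *: v) - f (a + t *: v))).
  apply/funext => h /=; congr (_ *: (f _ - _)).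
  by rewrite [h *: 1]mulr1 scalerDl addrCA.
by split; rewrite /derivable /derive E.
Qed.

Lemma mean_value f a v :
  (forall t : R, 0 <= t <= 1 -> derivable f (a + t *: v) v) ->
  exists2 t : R, 0 < t < 1 & f (a + v) - f a = 'D_v f (a + t *: v).
Proof.
move=> df.
have D (t : R) : 0 <= t <= 1 ->
    is_derive t 1 (fun s : R => f (a + s *: v)) ('D_v f (a + t *: v)).
  by move=> /df; exact: is_derive_line.
have [||t] := @MVT R (fun s => f (a + s *: v)) (fun t => 'D_v f (a + t *: v)) 0 1 ltr01.
- by move=> x; rewrite in_itv /= => /andP[x0 x1]; apply: D; rewrite !ltW.
- apply: derivable_within_continuous => x; rewrite in_itv /= => x01.
  by have [] := D x x01.
rewrite in_itv /= => t01; rewrite scale1r scale0r addr0 subr0 mulr1 => ->.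
by exists t.
Qed.

Lemma deriveZv f a v (k : R) : differentiable f a ->
  'D_(k *: v) f a = k * 'D_v f a.
Proof. by move=> df; rewrite !deriveE // linearZ. Qed.

Lemma is_derive_translate f a c v :
  derivable f (a + c) v -> is_derive a v (fun w => f (w + c)) ('D_v f (a + c)).
Proof.
move=> df.
have E : (fun h : R => h^-1 *: (((fun w => f (w + c)) \o shift a) (h *: v)
    - f (a + c))) =
  (fun h : R => h^-1 *: ((f \o shift (a + c)) (h *: v) - f (a + c))).
  by apply/funext => h /=; rewrite addrA.
by split; rewrite /derivable /derive E.
Qed.

(** Applying the mean value theorem to w |-> f (w + h v) - f w along h u leaves a
    difference of values of the single function D_u f at two points near z; its
    differentiability at z alone controls that difference up to o(h).  This is
    Young's form of the argument: the second derivatives need not be continuous. *)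
Lemma second_difference_cvg f z u v :
  (\forall w \near z, differentiable f w) -> differentiable ('D_u f) z ->
  (fun h : R => h^-1 ^+ 2 * (f (z + h *: u + h *: v) - f (z + h *: u)
     - (f (z + h *: v) - f z))) @ 0^' --> 'D_v ('D_u f) z.
Proof.
move=> df dg; apply/cvgrPdist_le => /= e e0.
(* K |h| bounds the sum of the distances from z to the two points compared, hence
   the tolerance e / (K + 1) in the expansion of D_u f at z. *)
pose K : R := 2 * (`|u| + `|v|).
have K0 : 0 <= K by rewrite mulr_ge0 // addr_ge0.
have e'0 : 0 < e / (K + 1) by rewrite divr_gt0 // ltr_pwDr.
have : \forall w \near (0 : V), differentiable f (w + z) /\
    `|'D_u f (w + z) - 'D_u f z - 'd ('D_u f) z w| <= e / (K + 1) * `|w|.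
  near=> w; split; near: w.
    by move: df; rewrite (near_shift 0) /= subr0; apply.
  have /diff_locally/eqaddoP/(_ _ e'0) := dg.
  by apply: filterS => w /=; rewrite !fctE /= opprD addrA.
move=> /nbhs_ballP[d /= d0 Hd].
have L1 : 0 < d / (K + 1) by rewrite divr_gt0 // ltr_pwDr.
near=> h.
have h0 : h != 0 by near: h; exact: nbhs_dnbhs_neq.
have hd : `|h| < d / (K + 1) by near: h; exact: dnbhs0_lt.
have bound (s t : R) : `|s| <= 1 -> `|t| <= 1 ->
    `|s *: (h *: u) + t *: (h *: v)| <= `|h| * (`|u| + `|v|).
  move=> s1 t1; apply: le_trans (ler_normD _ _) _; rewrite !normrZ mulrDr lerD //.
  - by rewrite -[leRHS]mul1r ler_wpM2r // mulr_ge0.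
  - by rewrite -[leRHS]mul1r ler_wpM2r // mulr_ge0.
have small (s t : R) : `|s| <= 1 -> `|t| <= 1 -> ball 0 d (s *: (h *: u) + t *: (h *: v)).
  move=> s1 t1; rewrite -ball_normE /= sub0r normrN.
  apply: le_lt_trans (bound _ _ s1 t1) _.
  have : `|h| * (K + 1) < d by rewrite -ltr_pdivlMr // ltr_pwDr.
  apply: le_lt_trans; rewrite ler_wpM2l // /K.
  by have := normr_ge0 u; have := normr_ge0 v; lra.
pose phi w := f (w + h *: v) - f w.
have dphi (t : R) : 0 <= t <= 1 -> is_derive (z + t *: (h *: u)) (h *: u) phi
    (h * ('D_u f (z + t *: (h *: u) + h *: v) - 'D_u f (z + t *: (h *: u)))).
  move=> t01; have t1 : `|t| <= 1 by rewrite ger0_norm; lra.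
  have d1 : differentiable f (z + t *: (h *: u) + h *: v).
    have /Hd[+ _] : ball 0 d (t *: (h *: u) + (1 : R) *: (h *: v)).
      by apply: small => //; rewrite normr1.
    by rewrite scale1r addrC addrA.
  have d2 : differentiable f (z + t *: (h *: u)).
    have /Hd[+ _] : ball 0 d (t *: (h *: u) + (0 : R) *: (h *: v)).
      by apply: small => //; rewrite normr0.
    by rewrite scale0r addr0 addrC.
  have D1 := is_derive_translate (diff_derivable (v := h *: u) d1).
  have D2 := derivableP (diff_derivable (v := h *: u) d2).
  by apply: (is_derive_eq (is_deriveB D1 D2)); rewrite !deriveZv // mulrBr.
have [t t01] := mean_value (fun (t : R) ht => @ex_derive _ _ _ _ _ _ _ (dphi t ht)).
have t01' : 0 <= t <= 1 by lra.
rewrite (@derive_val _ _ _ _ _ _ _ (dphi t t01')) /phi => ->.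
have t1 : `|t| <= 1 by rewrite ger0_norm; lra.
have /Hd[_ ] : ball 0 d (t *: (h *: u) + (1 : R) *: (h *: v)).
  by apply: small => //; rewrite normr1.
have /Hd[_ ] : ball 0 d (t *: (h *: u) + (0 : R) *: (h *: v)).
  by apply: small => //; rewrite normr0.
have := bound t 0 t1; rewrite normr0 ler01 => /(_ isT).
have := bound t 1 t1; rewrite normr1 lexx => /(_ isT).
rewrite !scale0r !addr0 !scale1r.
rewrite linearD /= -!deriveE // (@deriveZv _ z v h) // ![_ + z]addrC addrA.
set A := 'D_u f (z + _ + _); set B := 'D_u f (z + _); set C := 'D_u f z.
set Dv := 'D_v _ z; set Du := 'D_(_ *: _) _ z => b1 b2 E2 E1.
have -> : Dv - h^-1 ^+ 2 * (h * (A - B)) =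
    h^-1 * ((B - C - Du) - (A - C - (Du + h * Dv))).
  by field; exact: h0.
rewrite normrM normfV ler_pdivrMl ?normr_gt0 //.
apply: le_trans (ler_normB _ _) _; apply: le_trans (lerD E2 E1) _.
have K1 : 0 < K + 1 by lra.
rewrite -mulrDr mulrAC ler_pdivrMr // mulrC [leRHS]mulrAC ler_wpM2r ?(ltW e0) //.
apply: le_trans (lerD b2 b1) _.
by rewrite -mulrDr ler_wpM2l // /K; lra.
Unshelve. all: by end_near.
Qed.

(** The second difference is symmetric in u and v, so both mixed derivatives are
    limits of the same expression. *)
Lemma derive_comm f z u v :
  (\forall w \near z, differentiable f w) ->
  differentiable ('D_u f) z -> differentiable ('D_v f) z ->
  'D_v ('D_u f) z = 'D_u ('D_v f) z.
Proof.
move=> df du dv.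
have cu := @second_difference_cvg f z u v df du.
have := @second_difference_cvg f z v u df dv.
rewrite (_ : (fun h : R => _) = (fun h : R => h^-1 ^+ 2 *
    (f (z + h *: u + h *: v) - f (z + h *: u) - (f (z + h *: v) - f z)))).
  by move=> cv; rewrite -(cvg_lim (@Rhausdorff R) cu); exact: cvg_lim cv.
by apply/funext => h; rewrite [z + h *: v + _]addrAC; congr (_ * _); lra.
Qed.

Lemma segment_eq f a v :
  (forall t : R, 0 <= t <= 1 -> differentiable f (a + t *: v)) ->
  (forall t : R, 0 <= t <= 1 -> 'D_v f (a + t *: v) = 0) ->
  f (a + v) = f a.
Proof.
move=> df dz; have [t ht|t t01] := @mean_value f a v.
  exact/diff_derivable/df.
by rewrite dz => [/eqP|]; [rewrite subr_eq0 => /eqP|lra].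
Qed.

End Line.

(** * Stability properties of smooth functions *)

Section LinearMaps.
Context (R : realType) (V W : normedModType R) (l : V -> W).
Hypotheses (ll : linear l) (cl : continuous l).

Let L : {linear V -> W} := HB.pack l (GRing.isLinear.Build _ _ _ _ l ll).

Lemma differentiable_linear (z : V) : differentiable l z.
Proof. exact: (@linear_differentiable _ _ _ L). Qed.

Lemma derive_linear (z v : V) : 'D_v l z = l v.
Proof. by rewrite deriveE ?(@diff_lin _ _ _ L) //; exact: differentiable_linear. Qed.

End LinearMaps.

Section Smooth.
Context (R : realType) (V : normedModType R).

(** The differential is chosen by a description operator, so the expansion of f
    has to be transferred to g before the differential of g is known. *)
Lemma near_eq_differentiable (W : normedModType R) (f g : V -> W) (x : V) :
  {near x, f =1 g} -> differentiable f x -> differentiable g x.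
Proof.
move=> fg /diff_locallyP[dfc df].
have gx : g \o shift x = cst (g x) + 'd f x +o_ 0 id.
  apply/eqaddoP => e e0; move/eqaddoP/(_ e e0): df.
  have := fg; rewrite -(nbhs_singleton fg) (near_shift 0) /= => fg0.
  apply: filterS2 fg0 => w /=; rewrite subr0 !fctE /= => ->.
  by [].
by apply/diff_locallyP; rewrite (diff_unique dfc gx).
Qed.

Lemma open_near_eq (T : Type) (A : set V) (f g : V -> T) (x : V) :
  open A -> (forall y, A y -> f y = g y) -> A x -> {near x, f =1 g}.
Proof.
by move=> oA fg Ax; apply: filterS (fg) _; apply: open_nbhs_nbhs.
Qed.

Lemma Ck_on_ext (W : normedModType R) (A : set V) k (f g : V -> W) :
  open A -> (forall y, A y -> f y = g y) -> Ck_on A k f -> Ck_on A k g.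
Proof.
move=> oA; elim: k f g => [|k IH] f g fg /= => [cf x Ax|[df Df]].
  have nfg := open_near_eq oA fg Ax.
  rewrite /prop_for /continuous_at -(nbhs_singleton nfg).
  exact: cvg_trans (near_eq_cvg nfg) (cf x Ax).
split=> [x Ax|v].
  exact: near_eq_differentiable (open_near_eq oA fg Ax) (df x Ax).
apply: IH (Df v) => y Ay; apply: near_eq_derive.
exact: (open_near_eq oA fg Ay).
Qed.

Lemma Ck_onS (W : normedModType R) (A : set V) k (f : V -> W) :
  Ck_on A k.+1 f -> Ck_on A k f.
Proof.
elim: k f => [|k IH] f [df Df]; first by move=> x /df /differentiable_continuous.
by split=> // v; apply: IH.
Qed.

Context (A : set V) (oA : open A).
Implicit Types f g : V -> R.

Lemma smooth_differentiable (W : normedModType R) (f : V -> W) z :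
  smooth_on A f -> A z -> differentiable f z.
Proof. by move=> /(_ 1) [+ _]; apply. Qed.

Lemma smooth_derive (W : normedModType R) (f : V -> W) v :
  smooth_on A f -> smooth_on A ('D_v f).
Proof. by move=> sf k; have [_ +] := sf k.+1; apply. Qed.

Lemma smooth_on_ext (W : normedModType R) (f g : V -> W) :
  (forall y, A y -> f y = g y) -> smooth_on A f -> smooth_on A g.
Proof. by move=> fg sf k; apply: Ck_on_ext (sf k). Qed.

Lemma smooth_cst (W : normedModType R) (a : W) : smooth_on A (cst a).
Proof.
move=> k; elim: k a => [|k IH] a; first by move=> x _; exact: cst_continuous.
split=> [x _|v]; first exact: differentiable_cst.
apply: (Ck_on_ext (f := cst 0)) => // y _; exact/esym/derive_cst.
Qed.

Lemma smooth_linear (W W' : normedModType R) (l : W -> W') (f : V -> W) :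
  linear l -> continuous l -> smooth_on A f -> smooth_on A (fun x => l (f x)).
Proof.
move=> ll cl sf k; elim: k f sf => [|k IH] f sf.
  move=> x Ax; apply: continuous_comp; last exact: cl.
  exact/differentiable_continuous/(smooth_differentiable sf).
have df y Ay := @smooth_differentiable _ f y sf Ay.
have dl := differentiable_linear ll cl.
split=> [x Ax|v]; first exact: differentiable_comp (df x Ax) (dl _).
apply: Ck_on_ext oA _ (IH _ (smooth_derive v sf)) => y Ay.
rewrite [RHS](deriveE _ (differentiable_comp (df y Ay) (dl _))).
rewrite diff_comp //=; last exact: df.
by rewrite (deriveE _ (df y Ay)) -(deriveE _ (dl _)) derive_linear.
Qed.

Lemma smooth_id : smooth_on A (@id V).
Proof.
case=> [|k]; first by move=> x _.
split=> // v; apply: Ck_on_ext oA _ (smooth_cst v k) => y _.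
by rewrite derive_id.
Qed.

Lemma Ck_onD k f g :
  Ck_on A k f -> Ck_on A k g -> Ck_on A k (fun x => f x + g x).
Proof.
elim: k f g => [|k IH] f g; first by move=> cf cg x Ax; apply: cvgD; [exact: cf|exact: cg].
move=> [df Df] [dg Dg]; split=> [x Ax|v].
  by apply: differentiableD; [exact: df|exact: dg].
apply: Ck_on_ext oA _ (IH _ _ (Df v) (Dg v)) => y Ay.
by apply/esym/deriveD; apply/diff_derivable; [exact: df|exact: dg].
Qed.

(** The product rule for C^(k+1) uses the factors themselves as C^k functions. *)
Lemma Ck_onM k f g :
  Ck_on A k f -> Ck_on A k g -> Ck_on A k (fun x => f x * g x).
Proof.
elim: k f g => [|k IH] f g cf cg.
  by move=> x Ax; apply: cvgM; [exact: cf|exact: cg].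
have [df Df] := cf; have [dg Dg] := cg; split=> [x Ax|v].
  by apply: differentiableM; [exact: df|exact: dg].
apply: Ck_on_ext oA _ (Ck_onD (IH _ _ (Ck_onS cf) (Dg v)) (IH _ _ (Ck_onS cg) (Df v))) => y Ay.
by apply/esym/deriveM; apply/diff_derivable; [exact: df|exact: dg].
Qed.

Lemma smoothD f g :
  smooth_on A f -> smooth_on A g -> smooth_on A (fun x => f x + g x).
Proof. by move=> sf sg k; apply: Ck_onD. Qed.

Lemma smoothM f g :
  smooth_on A f -> smooth_on A g -> smooth_on A (fun x => f x * g x).
Proof. by move=> sf sg k; apply: Ck_onM. Qed.

Lemma smoothMl (a : R) f : smooth_on A f -> smooth_on A (fun x => a * f x).
Proof. by move=> sf; apply: (smoothM (f := cst a)) => //; exact: smooth_cst. Qed.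

Lemma smoothN f : smooth_on A f -> smooth_on A (fun x => - f x).
Proof.
move=> /(smoothMl (-1)); apply: smooth_on_ext => y _.
by rewrite mulN1r.
Qed.

Lemma smoothX2 f : smooth_on A f -> smooth_on A (fun x => f x ^+ 2).
Proof. by move=> sf; apply: (@smoothM f f). Qed.

Lemma smooth_derive_comm f z u v : smooth_on A f -> A z ->
  'D_v ('D_u f) z = 'D_u ('D_v f) z.
Proof.
move=> sf Az; apply: derive_comm.
- by apply: filterS (open_nbhs_nbhs (conj oA Az)) => w; exact: smooth_differentiable.
- exact/(smooth_differentiable _ Az)/smooth_derive.
- exact/(smooth_differentiable _ Az)/smooth_derive.
Qed.

End Smooth.

Section DeriveRules.
Context (R : realType) (V : normedModType R).
Implicit Types (f g : V -> R) (z u v : V).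

Lemma derive_subE f g z v : differentiable f z -> differentiable g z ->
  'D_v (fun x => f x - g x) z = 'D_v f z - 'D_v g z.
Proof. by move=> df dg; apply: deriveB; exact: diff_derivable. Qed.

Lemma derive_mulE f g z v : differentiable f z -> differentiable g z ->
  'D_v (fun x => f x * g x) z = f z * 'D_v g z + g z * 'D_v f z.
Proof. by move=> df dg; apply: deriveM; exact: diff_derivable. Qed.

Lemma derive_sqrE f z v : differentiable f z ->
  'D_v (fun x => f x ^+ 2) z = 2 * f z * 'D_v f z.
Proof. by move=> df; rewrite derive_mulE //; ring. Qed.

Lemma derive_scaleE f z v (a : R) : differentiable f z ->
  'D_v (fun x => a * f x) z = a * 'D_v f z.
Proof. by move=> df; apply: deriveZ; exact: diff_derivable. Qed.

Lemma derive_sumE n (h : 'I_n -> V -> R) z v :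
  (forall i, differentiable (h i) z) ->
  'D_v (fun x => \sum_i h i x) z = \sum_i 'D_v (h i) z.
Proof.
move=> dh; rewrite -derive_sum => [|i]; last exact: diff_derivable.
by congr (derive _ z v); apply/funext => x; rewrite fct_sumE.
Qed.

Lemma derive_chain (W : normedModType R) (t : V -> W) (f : W -> R) z v :
  differentiable t z -> differentiable f (t z) ->
  'D_v (f \o t) z = 'D_('D_v t z) f (t z).
Proof.
move=> dt df; rewrite (deriveE _ df) (deriveE _ dt).
by rewrite (deriveE _ (differentiable_comp dt df)) diff_comp.
Qed.

Lemma derive_near_cst f z v (a : R) :
  (\forall h \near 0^', h^-1 *: (f (h *: v + z) - f z) = a) -> 'D_v f z = a.
Proof. by move=> fa; apply: cvg_lim => //; exact: cvg_near_cst fa. Qed.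

End DeriveRules.

Section SmoothInverse.
Context (R : realType) (V : normedModType R) (A : set V) (oA : open A).

Lemma derive_invE (f : V -> R) z v : f z != 0 -> differentiable f z ->
  'D_v (fun x => (f x)^-1) z = - (f z)^-1 * (f z)^-1 * 'D_v f z.
Proof.
move=> fz df; rewrite deriveV //; last exact: diff_derivable.
by rewrite -exprVn expr2 mulNr.
Qed.

(** The derivative of 1/f is a product of the function 1/f with smooth ones, so
    the order of differentiability of 1/f rises by induction. *)
Lemma smoothV (f : V -> R) : (forall x, A x -> f x != 0) ->
  smooth_on A f -> smooth_on A (fun x => (f x)^-1).
Proof.
move=> f0 sf; elim=> [|k IH].
  move=> x Ax; apply: cvgV; first exact: f0.
  exact/differentiable_continuous/(smooth_differentiable sf).
have df x Ax := @smooth_differentiable _ _ A _ f x sf Ax.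
split=> [x Ax|v].
  by have := differentiableV (df x Ax) (f0 x Ax).
apply: (Ck_on_ext (f := fun x => (-1 * (f x)^-1) * (f x)^-1 * 'D_v f x)) => //.
  by move=> y Ay; rewrite derive_invE ?mulN1r //; [exact: f0|exact: df].
apply: Ck_onM => //; last exact: smooth_derive.
by apply: Ck_onM => //; apply: Ck_onM => //; exact: smooth_cst.
Qed.

End SmoothInverse.

(** * The ring of smooth functions on an open set *)

Section SmoothRing.
Context (R : realType) (V : normedModType R) (A : set V) (oA : open A).

(** Functions that agree on [A] must be equal for a ring structure, hence the value
    0 outside of [A].  The openness proof is a parameter because the ring
    operations are defined through it. *)
Record smooth_fun (oA : open A) := SmoothFun {
  sfun :> V -> R ;
  sfun_smooth : smooth_on A sfun ;
  sfun_out : forall x, ~ A x -> sfun x = 0 }.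

Local Notation T := (smooth_fun oA).

Lemma sfun_ext (f g : T) : (forall x, A x -> f x = g x) -> f = g.
Proof.
case: f g => [f sf of_] [g sg og] /= fg.
have E : f = g.
  apply/funext => x; have [/fg//|nAx] := pselect (A x).
  by rewrite of_ // og.
by subst g; congr SmoothFun; exact: Prop_irrelevance.
Qed.

Definition restrict0 (f : V -> R) (x : V) : R := if `[< A x >] then f x else 0.

Lemma restrict0E f x : A x -> restrict0 f x = f x.
Proof. by rewrite /restrict0; case: asboolP. Qed.

Lemma restrict0_smooth f : smooth_on A f -> smooth_on A (restrict0 f).
Proof. by apply: smooth_on_ext => // x /restrict0E. Qed.

Lemma restrict0_out f x : ~ A x -> restrict0 f x = 0.
Proof. by rewrite /restrict0; case: asboolP. Qed.

Definition to_sfun f (sf : smooth_on A f) : T :=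
  SmoothFun oA (restrict0_smooth sf) (@restrict0_out f).

Definition sfun_cst (a : R) : T := to_sfun (smooth_cst oA a).

Lemma sfun_opp_out (f : T) x : ~ A x -> - f x = 0.
Proof. by move=> /(sfun_out f) ->; rewrite oppr0. Qed.
Lemma sfun_add_out (f g : T) x : ~ A x -> f x + g x = 0.
Proof. by move=> Ax; rewrite !sfun_out ?addr0. Qed.
Lemma sfun_mul_out (f g : T) x : ~ A x -> f x * g x = 0.
Proof. by move=> Ax; rewrite !sfun_out ?mulr0. Qed.

Definition sfun_opp (f : T) : T :=
  SmoothFun oA (smoothN oA (sfun_smooth f)) (@sfun_opp_out f).
Definition sfun_add (f g : T) : T :=
  SmoothFun oA (smoothD oA (sfun_smooth f) (sfun_smooth g)) (@sfun_add_out f g).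
Definition sfun_mul (f g : T) : T :=
  SmoothFun oA (smoothM oA (sfun_smooth f) (sfun_smooth g)) (@sfun_mul_out f g).

HB.instance Definition _ := gen_eqMixin T.
HB.instance Definition _ := gen_choiceMixin T.

Lemma sfun_addA : associative sfun_add.
Proof. by move=> f g h; apply: sfun_ext => x _; exact: addrA. Qed.
Lemma sfun_addC : commutative sfun_add.
Proof. by move=> f g; apply: sfun_ext => x _; exact: addrC. Qed.
Lemma sfun_add0 : left_id (sfun_cst 0) sfun_add.
Proof. by move=> f; apply: sfun_ext => x Ax /=; rewrite restrict0E // add0r. Qed.
Lemma sfun_addN : left_inverse (sfun_cst 0) sfun_opp sfun_add.
Proof. by move=> f; apply: sfun_ext => x Ax /=; rewrite restrict0E // addNr. Qed.
HB.instance Definition _ :=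
  GRing.isZmodule.Build T sfun_addA sfun_addC sfun_add0 sfun_addN.

Lemma sfun_mulA : associative sfun_mul.
Proof. by move=> f g h; apply: sfun_ext => x _; exact: mulrA. Qed.
Lemma sfun_mulC : commutative sfun_mul.
Proof. by move=> f g; apply: sfun_ext => x _; exact: mulrC. Qed.
Lemma sfun_mul1 : left_id (sfun_cst 1) sfun_mul.
Proof. by move=> f; apply: sfun_ext => x Ax /=; rewrite restrict0E // mul1r. Qed.
Lemma sfun_mulDl : left_distributive sfun_mul sfun_add.
Proof. by move=> f g h; apply: sfun_ext => x _; exact: mulrDl. Qed.
HB.instance Definition _ :=
  GRing.Zmodule_isComPzRing.Build T sfun_mulA sfun_mulC sfun_mul1 sfun_mulDl.

Definition sfun_derive (v : V) (f : T) : T :=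
  to_sfun (smooth_derive v (sfun_smooth f)).

Lemma sfun_derive_is_zmod_morphism v : zmod_morphism (sfun_derive v).
Proof.
move=> f g; apply: sfun_ext => x Ax /=; rewrite !restrict0E //.
by apply: derive_subE; [exact: smooth_differentiable (sfun_smooth f) Ax
                       |exact: smooth_differentiable (sfun_smooth g) Ax].
Qed.
HB.instance Definition _ v :=
  GRing.isZmodMorphism.Build T T (sfun_derive v) (sfun_derive_is_zmod_morphism v).

End SmoothRing.

(** Interface through which the ring of smooth functions on [A] is used.  Elements
    are determined by their values on [A], so identities between them may be
    checked pointwise, where the derivations are directional derivatives. *)
Record smooth_ring (R : realType) (V : normedModType R) (A : set V) := SmoothRing {
  sring :> comPzRingType ;
  seval : V -> sring -> R ;
  sfunc : forall f : V -> R, smooth_on A f -> sring ;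
  sderive : V -> {additive sring -> sring} ;
  seval_inj : forall a b : sring,
    (forall z, A z -> seval z a = seval z b) -> a = b ;
  sevalB : forall z a b, seval z (a - b) = seval z a - seval z b ;
  sevalM : forall z a b, seval z (a * b) = seval z a * seval z b ;
  seval1 : forall z, A z -> seval z 1 = 1 ;
  seval_smooth : forall a, smooth_on A (seval^~ a) ;
  seval_sfunc : forall f (sf : smooth_on A f) z, A z -> seval z (sfunc sf) = f z ;
  seval_derive : forall v a z, A z -> seval z (sderive v a) = 'D_v (seval^~ a) z
}.

Lemma smooth_ring_of (R : realType) (V : normedModType R) (A : set V) :
  open A -> smooth_ring A.
Proof.
move=> oA; apply: (@SmoothRing R V A (smooth_fun oA) (fun z f => f z)
  (fun f sf => to_sfun oA sf) (fun v => @sfun_derive R V A oA v)) => //.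
- exact: sfun_ext.
- by move=> z Az; exact: restrict0E.
- exact: sfun_smooth.
- by move=> f sf z Az; exact: restrict0E.
- by move=> v f z Az; exact: restrict0E.
Qed.

Section SmoothRingTheory.
Context (R : realType) (V : normedModType R) (A : set V) (oA : open A).
Context (T : smooth_ring A).
Implicit Types (f g : T) (z u v : V).

Lemma seval0 z : seval z (0 : T) = 0.
Proof. by rewrite -(subrr (0 : T)) sevalB subrr. Qed.

Lemma sevalN z f : seval z (- f) = - seval z f.
Proof. by rewrite -sub0r sevalB seval0 sub0r. Qed.

Lemma sevalD z f g : seval z (f + g) = seval z f + seval z g.
Proof. by rewrite -[g in LHS]opprK sevalB sevalN opprK. Qed.

Lemma seval_sum z (I : Type) (r : seq I) (F : I -> T) :
  seval z (\sum_(i <- r) F i) = \sum_(i <- r) seval z (F i).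
Proof. exact: (big_morph _ (sevalD z) (seval0 z)). Qed.

Lemma seval_nat z m : A z -> seval z (m%:R : T) = m%:R.
Proof.
move=> Az; elim: m => [|m IH]; first exact: seval0.
by rewrite !mulrS sevalD IH seval1.
Qed.

(** Identities are kept free of 1/2, and this is how the factor 2 is removed. *)
Lemma sring_two_reg f : 2 * f = 0 -> f = 0.
Proof.
move=> f0; apply: seval_inj => z Az; rewrite seval0.
have := congr1 (seval z) f0; rewrite sevalM seval0 seval_nat // => /eqP.
by rewrite mulf_eq0 pnatr_eq0 /= => /eqP.
Qed.

Lemma seval_differentiable f z : A z -> differentiable (fun w => seval w f) z.
Proof. exact: smooth_differentiable (@seval_smooth _ _ _ T f). Qed.

Lemma sderiveM v f g : sderive T v (f * g) = f * sderive T v g + g * sderive T v f.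
Proof.
apply: seval_inj => z Az; rewrite sevalD !sevalM !seval_derive //.
rewrite -derive_mulE; [|exact: seval_differentiable..].
by congr (derive _ z v); apply/funext => w; exact: sevalM.
Qed.

Lemma sderive_comm u v f :
  sderive T u (sderive T v f) = sderive T v (sderive T u f).
Proof.
have E s t z : A z -> seval z (sderive T s (sderive T t f)) =
    'D_s ('D_t (fun w => seval w f)) z.
  move=> Az; rewrite seval_derive //; apply: near_eq_derive.
  by apply: (open_near_eq oA _ Az) => y; exact: seval_derive.
apply: seval_inj => z Az; rewrite (E u v z Az) (E v u z Az).
by apply: (smooth_derive_comm oA _ _ _ Az); exact: seval_smooth.
Qed.

End SmoothRingTheory.

(** * Vector fields over a ring with commuting derivations *)

Section VectorFields.
Context (A : comPzRingType) (I : finType) (d : I -> {additive A -> A}).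
Hypothesis dM : forall i f g, d i (f * g) = f * d i g + g * d i f.
Hypothesis dC : forall i j f, d i (d j f) = d j (d i f).

Definition vfield (c : I -> A) (f : A) : A := \sum_i c i * d i f.

Lemma vfield_is_zmod_morphism c : zmod_morphism (vfield c).
Proof.
move=> f g; rewrite /vfield -sumrB; apply: eq_bigr => i _.
by rewrite raddfB mulrBr.
Qed.
HB.instance Definition _ c :=
  GRing.isZmodMorphism.Build A A (vfield c) (vfield_is_zmod_morphism c).

Lemma vfieldM c f g : vfield c (f * g) = f * vfield c g + g * vfield c f.
Proof.
rewrite /vfield !mulr_sumr -big_split; apply: eq_bigr => i _ /=.
by rewrite dM; ring.
Qed.

Lemma vfield_ext c c' f : c =1 c' -> vfield c f = vfield c' f.
Proof. by move=> cc; apply: eq_bigr => i _; rewrite cc. Qed.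

(** The second-order parts of the two compositions agree because the derivations
    commute; what remains is the Lie bracket. *)
Lemma vfield_bracket a b f :
  vfield a (vfield b f) =
  vfield b (vfield a f) + vfield (fun i => vfield a (b i) - vfield b (a i)) f.
Proof.
have H c e : vfield c (vfield e f) = vfield (fun i => vfield c (e i)) f +
    \sum_i \sum_j e i * c j * d j (d i f).
  rewrite {2}/vfield raddf_sum -big_split; apply: eq_bigr => i _ /=.
  rewrite vfieldM // addrC [d i f * _]mulrC mulr_sumr; congr (_ + _).
  by apply: eq_bigr => j _; rewrite mulrA.
rewrite !H addrAC; congr (_ + _).
  by rewrite /vfield -big_split; apply: eq_bigr => i _ /=; rewrite mulrBl subrKC.
rewrite exchange_big; apply: eq_bigr => i _; apply: eq_bigr => j _ /=.
by rewrite dC [b _ * _]mulrC.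
Qed.

Lemma vfield_commutator a b c f :
  (forall i, c i = vfield a (b i) - vfield b (a i)) ->
  vfield a (vfield b f) = vfield b (vfield a f) + vfield c f.
Proof. by move=> cE; rewrite vfield_bracket -(vfield_ext f cE). Qed.

End VectorFields.

(** * Sprays, their connection and their Jacobi endomorphism *)

Section Spray.
Context (A : comPzRingType) (n : nat) (d : 'I_n + 'I_n -> {additive A -> A}).
Hypothesis dM : forall i f g, d i (f * g) = f * d i g + g * d i f.
Hypothesis dC : forall i j f, d i (d j f) = d j (d i f).
Local Notation dX i := (d (inl i)).
Local Notation dY i := (d (inr i)).
Context (y : 'I_n -> A).
Hypothesis dXy : forall i j, dX i (y j) = 0.
Hypothesis dYy : forall i j, dY i (y j) = (i == j)%:R.
Implicit Types (f P L : A) (G : 'I_n -> A) (i j k : 'I_n).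

Definition split_coefs (a b : 'I_n -> A) (s : 'I_n + 'I_n) : A :=
  match s with inl i => a i | inr i => b i end.

Lemma vfield_split a b f : vfield d (split_coefs a b) f =
  \sum_i a i * dX i f + \sum_i b i * dY i f.
Proof. by rewrite /vfield big_sumType. Qed.

Lemma sum_delta (a : 'I_n -> A) j : \sum_i (i == j)%:R * a i = a j.
Proof.
rewrite (bigD1 j) //= eqxx mul1r big1 ?addr0 // => i /negPf ->.
by rewrite mul0r.
Qed.

Lemma sum_deltar (a : 'I_n -> A) j : \sum_i a i * (i == j)%:R = a j.
Proof. by under eq_bigr do rewrite mulrC; exact: sum_delta. Qed.

(** N^i_j.  The next three are the Liouville field, the spray y^i d/dx^i - 2 G^i d/dy^i
    and the horizontal field delta/delta x^j. *)
Definition conn G i j : A := dY j (G i).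
Definition radial := vfield d (split_coefs (fun=> 0) y).
Definition spray G := vfield d (split_coefs y (fun i => - (2 * G i))).
Definition hor G j :=
  vfield d (split_coefs (fun i => (i == j)%:R) (fun i => - conn G i j)).
Definition jacobi G i j : A :=
  2 * hor G j (G i) - spray G (conn G i j) + \sum_k conn G i k * conn G k j.

HB.instance Definition _ :=
  GRing.isZmodMorphism.Build A A radial (vfield_is_zmod_morphism d _).
HB.instance Definition _ G :=
  GRing.isZmodMorphism.Build A A (spray G) (vfield_is_zmod_morphism d _).
HB.instance Definition _ G j :=
  GRing.isZmodMorphism.Build A A (hor G j) (vfield_is_zmod_morphism d _).

Lemma radialE f : radial f = \sum_i y i * dY i f.
Proof. by rewrite /radial vfield_split big1 ?add0r // => i _; rewrite mul0r. Qed.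

Lemma sprayE G f : spray G f = \sum_i y i * dX i f - 2 * \sum_i G i * dY i f.
Proof.
rewrite /spray vfield_split mulr_sumr -sumrN; congr (_ + _).
by apply: eq_bigr => i _; rewrite mulNr mulrA.
Qed.

Lemma horE G j f : hor G j f = dX j f - \sum_i conn G i j * dY i f.
Proof.
rewrite /hor vfield_split sum_delta -sumrN; congr (_ + _).
by apply: eq_bigr => i _; rewrite mulNr.
Qed.

Lemma vfield_dX j : dX j =1 vfield d (split_coefs (fun i => (i == j)%:R) (fun=> 0)).
Proof.
by move=> f; rewrite vfield_split sum_delta [X in _ + X]big1 ?addr0 // => i _; rewrite mul0r.
Qed.

Lemma vfield_dY j : dY j =1 vfield d (split_coefs (fun=> 0) (fun i => (i == j)%:R)).
Proof.
by move=> f; rewrite vfield_split sum_delta big1 ?add0r // => i _; rewrite mul0r.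
Qed.

Lemma spray_y G i : spray G (y i) = - (2 * G i).
Proof.
rewrite sprayE big1 => [|j _]; last by rewrite dXy mulr0.
by under eq_bigr do rewrite dYy; rewrite sum_deltar sub0r.
Qed.

Lemma hor_y G j i : hor G j (y i) = - conn G i j.
Proof.
rewrite horE dXy sub0r.
by under eq_bigr do rewrite dYy; rewrite sum_deltar.
Qed.

Lemma radial_y i : radial (y i) = y i.
Proof. by rewrite radialE; under eq_bigr do rewrite dYy; rewrite sum_deltar. Qed.

Lemma der1 s : d s 1 = 0.
Proof. by apply: (addrI (d s 1)); rewrite addr0 -[in RHS](mulr1 1) dM mul1r. Qed.

Lemma der_nat s m : d s m%:R = 0.
Proof. by rewrite raddfMn /= der1 mul0rn. Qed.

Lemma der_dbl s f : d s (2 * f) = 2 * d s f.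
Proof. by rewrite dM der_nat mulr0 addr0. Qed.

Lemma vfield_nat c m : vfield d c m%:R = 0.
Proof. by rewrite /vfield big1 // => i _; rewrite der_nat mulr0. Qed.

Lemma vfield_dbl c f : vfield d c (2 * f) = 2 * vfield d c f.
Proof. by rewrite vfieldM // vfield_nat mulr0 addr0. Qed.

(** [d/dy^j, S] has components (delta^i_j, - 2 N^i_j). *)
Lemma dY_spray G j f : dY j (spray G f) = spray G (dY j f) + 2 * hor G j f - dX j f.
Proof.
rewrite (vfield_dY j (spray G f)) vfield_bracket // -vfield_dY -addrA.
congr (_ + _); rewrite (vfield_ext _ _ (c' := split_coefs (fun i => (i == j)%:R)
    (fun i => - (2 * conn G i j)))); last first.
  move=> [i|i] /=; rewrite -vfield_dY.
    by rewrite raddf0 subr0 dYy eq_sym.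
  by rewrite vfield_nat subr0 raddfN /= der_dbl.
rewrite vfield_split sum_delta horE.
have -> : \sum_i - (2 * conn G i j) * dY i f = - (2 * \sum_i conn G i j * dY i f).
  by rewrite mulr_sumr -sumrN; apply: eq_bigr => i _; ring.
by ring.
Qed.

(** The horizontal part of [S, delta/delta x^j] is N^k_j d/dx^k, and completing it to
    N^k_j delta/delta x^k leaves exactly the defining expression of R^i_j. *)
Lemma spray_hor G j f :
  spray G (hor G j f) = hor G j (spray G f) + \sum_k conn G k j * hor G k f
    + \sum_i jacobi G i j * dY i f.
Proof.
rewrite {1}/spray {1}/hor vfield_bracket // -addrA; congr (_ + _).
rewrite (vfield_ext _ _ (c' := split_coefs (fun i => conn G i j)
    (fun i => 2 * hor G j (G i) - spray G (conn G i j)))); last first.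
  move=> [i|i] /=; rewrite -/(spray G) -/(hor G j).
    by rewrite /spray vfield_nat hor_y sub0r opprK.
  by rewrite !raddfN /= opprK {1}/hor vfield_dbl addrC.
rewrite vfield_split.
have -> : \sum_i (2 * hor G j (G i) - spray G (conn G i j)) * dY i f =
  \sum_i jacobi G i j * dY i f -
  \sum_i (\sum_k conn G i k * conn G k j) * dY i f.
  by rewrite -sumrB; apply: eq_bigr => i _; rewrite /jacobi; ring.
have -> : \sum_k conn G k j * hor G k f = \sum_k conn G k j * dX k f -
  \sum_i (\sum_k conn G i k * conn G k j) * dY i f.
  have -> : \sum_i (\sum_k conn G i k * conn G k j) * dY i f =
    \sum_k \sum_i conn G i k * conn G k j * dY i f.
    by rewrite exchange_big /=; apply: eq_bigr => i _; rewrite mulr_suml.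
  rewrite -sumrB; apply: eq_bigr => k _; rewrite horE mulrBr mulr_sumr.
  by congr (_ - _); apply: eq_bigr => i _; ring.
by ring.
Qed.

Lemma radial_dX j f : radial (dX j f) = dX j (radial f).
Proof.
rewrite !vfield_dX /radial (vfield_commutator dM dC (c := fun=> 0)) //.
  by rewrite [X in _ + X]big1 ?addr0 // => i _; rewrite mul0r.
move=> [i|i] /=; rewrite -vfield_dX.
  by rewrite raddf0 vfield_nat subr0.
by rewrite dXy raddf0 subr0.
Qed.

Lemma radial_dY j f : radial (dY j f) = dY j (radial f) - dY j f.
Proof.
rewrite !vfield_dY /radial (vfield_commutator dM dC
  (c := split_coefs (fun=> 0) (fun i => - (i == j)%:R))) //.
  congr (_ + _); rewrite /vfield -sumrN; apply: eq_bigr => -[i|i] _ /=; ring.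
move=> [i|i] /=; rewrite -vfield_dY.
  by rewrite !raddf0 addr0.
by rewrite dYy vfield_nat sub0r eq_sym.
Qed.

(** [C, S] = S holds up to the defect of homogeneity of the coefficients. *)
Lemma radial_spray G f : radial (spray G f) = spray G (radial f) + spray G f
  - 2 * \sum_i (radial (G i) - 2 * G i) * dY i f.
Proof.
rewrite {1}/radial {1}/spray vfield_bracket // -addrA; congr (_ + _).
rewrite (vfield_ext _ _ (c' := split_coefs y
    (fun i => 2 * G i - 2 * radial (G i)))); last first.
  move=> [i|i] /=; rewrite -/(spray G) -/radial.
    by rewrite raddf0 subr0 radial_y.
  rewrite raddfN /= {1}/radial vfield_dbl -/radial spray_y; ring.
rewrite vfield_split sprayE -addrA; congr (_ + _).
by rewrite !mulr_sumr -opprD -big_split -sumrN; apply: eq_bigr => i _ /=; ring.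
Qed.

Hypothesis two_reg : forall a : A, 2 * a = 0 -> a = 0.

Lemma sprayM G f g : spray G (f * g) = f * spray G g + g * spray G f.
Proof. exact: vfieldM. Qed.
Lemma horM G j f g : hor G j (f * g) = f * hor G j g + g * hor G j f.
Proof. exact: vfieldM. Qed.
Lemma radialM f g : radial (f * g) = f * radial g + g * radial f.
Proof. exact: vfieldM. Qed.

(** The Euler-Lagrange equation delta_S f = 0. *)
Definition extremal G f := forall j, spray G (dY j f) = dX j f.

Lemma extremal_hor G f j : extremal G f -> dY j (spray G f) = 2 * hor G j f.
Proof. by move=> ef; rewrite dY_spray ef addrAC subrr add0r. Qed.

(** Conservation of energy: differentiating 2 L = y^j dL/dy^j along S and using the
    Euler-Lagrange equation gives 2 S(L) = S(L). *)
Lemma spray_extremal2 G L : radial L = 2 * L -> extremal G L -> spray G L = 0.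
Proof.
move=> L2 eL; apply: (addrI (spray G L)); rewrite addr0.
have : spray G (radial L) = spray G L.
  rewrite radialE raddf_sum [RHS]sprayE mulr_sumr -sumrN -big_split.
  by apply: eq_bigr => j _ /=; rewrite sprayM eL spray_y; ring.
rewrite L2 {1}/spray vfield_dbl -/(spray G) => E; rewrite -[RHS]E; ring.
Qed.

Lemma hor_extremal2 G L j : radial L = 2 * L -> extremal G L -> hor G j L = 0.
Proof.
move=> L2 eL; apply: two_reg.
by rewrite -extremal_hor // spray_extremal2 // raddf0.
Qed.

(** Both S and delta/delta x^j annihilate L, and so does their commutator. *)
Lemma jacobi_extremal2 G L j : radial L = 2 * L -> extremal G L ->
  \sum_i jacobi G i j * dY i L = 0.
Proof.
move=> L2 eL; have hL i := hor_extremal2 i L2 eL; have := spray_hor G j L.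
rewrite (spray_extremal2 L2 eL) hL !raddf0 add0r.
by rewrite big1 ?add0r => [<- //|k _]; rewrite hL mulr0.
Qed.

(** Apply the formula for [C, S] to dL/dy^j: all other terms cancel by homogeneity and
    the Euler-Lagrange equation.  A nondegenerate Hessian then forces the
    coefficients G^i to be 2-homogeneous. *)
Lemma radial_spray_coef G L j : radial L = 2 * L -> extremal G L ->
  \sum_i (radial (G i) - 2 * G i) * dY i (dY j L) = 0.
Proof.
move=> L2 eL; have := radial_spray G (dY j L); rewrite eL.
rewrite radial_dX radial_dY L2 !der_dbl raddfB /= eL /spray vfield_dbl -/(spray G) eL.
set s := \sum_i _ => /eqP; rewrite -subr_eq0 => /eqP E.
apply: two_reg; rewrite -[RHS]E; ring.
Qed.

Definition proj_coefs G P i : A := G i + P * y i.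

Section Projective.
Context (G : 'I_n -> A) (P : A).
Hypothesis homG : forall i, radial (G i) = 2 * G i.
Hypothesis homP : radial P = P.
Local Notation G' := (proj_coefs G P).

Lemma conn_proj i j :
  conn G' i j = conn G i j + P * (i == j)%:R + y i * dY j P.
Proof. by rewrite /conn /proj_coefs raddfD /= dM dYy eq_sym addrA. Qed.

Lemma spray_proj f : spray G' f = spray G f - 2 * P * radial f.
Proof.
rewrite !sprayE radialE -addrA -opprD -mulrA -mulrDr; congr (_ - 2 * _).
by rewrite mulr_sumr -big_split; apply: eq_bigr => i _ /=; rewrite /proj_coefs; ring.
Qed.

Lemma hor_proj j f : hor G' j f = hor G j f - P * dY j f - dY j P * radial f.
Proof.
rewrite !horE radialE.
have -> : P * dY j f = \sum_i P * (i == j)%:R * dY i f.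
  rewrite -[in LHS](sum_delta (fun i => dY i f) j) mulr_sumr.
  by apply: eq_bigr => i _; rewrite mulrA.
rewrite -!addrA -!opprD mulr_sumr -!big_split; congr (_ - _).
by apply: eq_bigr => i _ /=; rewrite conn_proj; ring.
Qed.

Lemma radial_conn i j : radial (conn G i j) = conn G i j.
Proof. by rewrite /conn radial_dY homG der_dbl; ring. Qed.

Lemma conn_y i : \sum_k conn G i k * y k = 2 * G i.
Proof. by rewrite -homG radialE; apply: eq_bigr => k _; rewrite mulrC. Qed.

Lemma dYP_y : \sum_k dY k P * y k = P.
Proof. by rewrite -[RHS]homP radialE; apply: eq_bigr => k _; rewrite mulrC. Qed.

Lemma radial_dYP j : radial (dY j P) = 0.
Proof. by rewrite radial_dY homP subrr. Qed.

Lemma conn_proj_sqr i j : \sum_k conn G' i k * conn G' k j =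
  \sum_k conn G i k * conn G k j + 2 * P * conn G i j + 2 * dY j P * G i
  + P ^+ 2 * (i == j)%:R + 3 * P * y i * dY j P
  + y i * \sum_k conn G k j * dY k P.
Proof.
have E k : conn G' i k * conn G' k j =
    conn G i k * conn G k j + P * (conn G i k * (k == j)%:R)
    + dY j P * (conn G i k * y k)
    + P * ((k == i)%:R * (conn G k j + P * (k == j)%:R + y k * dY j P))
    + y i * (conn G k j * dY k P) + P * y i * (dY k P * (k == j)%:R)
    + y i * dY j P * (dY k P * y k).
  by rewrite !conn_proj [k == i]eq_sym; ring.
under eq_bigr do rewrite E.
rewrite !big_split /= -!mulr_sumr !sum_deltar conn_y dYP_y.
by rewrite sum_delta; ring.
Qed.

(** The terms P N^i_j and G^i dP/dy^j cancel; this uses that G is 2-homogeneous and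
    P is 1-homogeneous. *)
Lemma jacobi_proj i j : jacobi G' i j = jacobi G i j
  + (P ^+ 2 - spray G P) * (i == j)%:R
  + y i * (2 * hor G j P - P * dY j P
           - (spray G (dY j P) - \sum_k conn G k j * dY k P)).
Proof.
rewrite /jacobi conn_proj_sqr hor_proj spray_proj conn_proj /proj_coefs.
rewrite !raddfD /= !horM !sprayM !radialM hor_y spray_y radial_y homG homP.
rewrite radial_dYP radial_conn dM dYy /radial /spray !vfield_nat -/radial -/(spray G).
by rewrite [j == i]eq_sym -/(conn G i j); ring.
Qed.

(** Under the Hamel equation the coefficient of y^i in [jacobi_proj] becomes
    delta P/delta x^j - P dP/dy^j, and delta P/delta x^j = 1/2 dS(P)/dy^j by
    [extremal_hor]. *)
Lemma jacobi_proj_extremal i j : extremal G P ->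
  let rho := P ^+ 2 - spray G P in
  2 * jacobi G' i j = 2 * jacobi G i j + 2 * rho * (i == j)%:R - y i * dY j rho.
Proof.
move=> eP rho; rewrite /rho jacobi_proj [dY j (_ - _)]raddfB /= extremal_hor // dM eP.
by rewrite horE; ring.
Qed.

End Projective.

(** The algebraic core.  The first conclusion makes u = rho / L' a function on the
    base, the second one says that it is the flag curvature of L', and the third
    one forces it to be locally constant. *)
Theorem constant_curvature_proj G P L L' (M kappa : A) :
  (forall i, radial (G i) = 2 * G i) ->
  radial P = P -> extremal G P ->
  radial L = 2 * L -> extremal G L ->
  (forall s, d s kappa = 0) ->
  (forall i j, 2 * jacobi G i j = kappa * (2 * L * (i == j)%:R - y i * dY j L)) ->
  let G' := proj_coefs G P in
  radial L' = 2 * L' -> extremal G' L' -> M * L' = 1 ->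
  let u := M * (kappa * L + P ^+ 2 - spray G P) in
  [/\ forall j, dY j u = 0,
      forall i j, 2 * jacobi G' i j = u * (2 * L' * (i == j)%:R - y i * dY j L')
    & forall j, dY j L' * (\sum_i y i * dX i u) = 2 * L' * dX j u].
Proof.
move=> homG homP eP L2 eL k0 RG G' L2' eL' ML' u.
have kc c : vfield d c kappa = 0 by rewrite /vfield big1 // => s _; rewrite k0 mulr0.
set Q := spray G P in u *.
pose rho := kappa * L + P ^+ 2 - Q.
have rhoE : rho = u * L' by rewrite /u mulrAC ML' mul1r.
have rhoD (D : {additive A -> A}) :
    (forall f g, D (f * g) = f * D g + g * D f) -> D kappa = 0 ->
    D rho = kappa * D L + 2 * P * D P - D Q.
  by move=> DM Dk; rewrite /rho raddfB raddfD /= !DM Dk; ring.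
have R'E i j : 2 * jacobi G' i j = 2 * rho * (i == j)%:R - y i * dY j rho.
  rewrite jacobi_proj_extremal // RG -/Q (rhoD (dY j)) // raddfB /= dM /rho; ring.
have L'reg a : L' * a = 0 -> a = 0.
  by move=> La; rewrite -[a]mul1r -ML' -mulrA La mulr0.
(* Contract the formula for the new Jacobi endomorphism with dL'/dy^i. *)
have uY j : dY j u = 0.
  have : 2 * \sum_i jacobi G' i j * dY i L' = 0.
    by rewrite jacobi_extremal2 ?mulr0.
  rewrite mulr_sumr.
  have E i : 2 * (jacobi G' i j * dY i L') =
    2 * rho * ((i == j)%:R * dY i L') - dY j rho * (y i * dY i L').
    by rewrite mulrA R'E; ring.
  under eq_bigr do rewrite E.
  rewrite sumrB -!mulr_sumr sum_delta -radialE L2' rhoE dM => /eqP H.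
  apply/L'reg/L'reg/two_reg/eqP; rewrite -oppr_eq0 -(eqP H); apply/eqP; ring.
have rY j : dY j rho = u * dY j L' by rewrite rhoE dM uY mulr0 addr0.
split=> // [i j|j]; first by rewrite R'E rY rhoE; ring.
have SL := spray_extremal2 L2 eL.
have hL i := hor_extremal2 i L2 eL.
have SL' := spray_extremal2 L2' eL'.
have hL' i := hor_extremal2 i L2' eL'.
have uX i : hor G' i u = dX i u.
  by rewrite horE big1 ?subr0 // => l _; rewrite uY mulr0.
have radQ : radial Q = 2 * Q.
  rewrite radial_spray homP big1 ?mulr0 ?subr0; first by rewrite /Q; ring.
  by move=> i _; rewrite homG subrr mul0r.
have rad_rho : radial rho = 2 * rho.
  by have /= -> := rhoD radial radialM (kc _); rewrite homP radQ L2 /rho; ring.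
have QY i : dY i Q = 2 * hor G i P by rewrite extremal_hor.
(* Write dS(Q)/dy^j with the first commutator, then move S across delta/delta x^j in
   S (dQ/dy^j) = 2 S (delta P/delta x^j) with the second one. *)
have SQY : dY j (spray G Q) = 3 * hor G j Q + kappa * (2 * L * dY j P - P * dY j L).
  rewrite dY_spray QY /spray vfield_dbl -/(spray G) spray_hor.
  have -> : dX j Q = hor G j Q + 2 * \sum_i conn G i j * hor G i P.
    rewrite horE mulr_sumr -[LHS](subrK (\sum_i conn G i j * dY i Q)).
    by congr (_ + _); apply: eq_bigr => i _; rewrite QY; ring.
  have E : 2 * \sum_i jacobi G i j * dY i P = kappa * (2 * L * dY j P - P * dY j L).
    rewrite mulr_sumr.
    have E i : 2 * (jacobi G i j * dY i P) =
      2 * kappa * L * ((i == j)%:R * dY i P) - kappa * dY j L * (y i * dY i P).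
      by rewrite mulrA RG; ring.
    under eq_bigr do rewrite E.
    by rewrite sumrB -!mulr_sumr sum_delta -radialE homP; ring.
  by rewrite -E -/Q; ring.
(* The curvature terms of the previous identity are precisely those needed for this
   closed form. *)
have w : dY j (spray G' rho) = 3 * hor G' j rho.
  have -> : spray G' rho = 6 * P * Q - spray G Q - 4 * kappa * P * L - 4 * P ^+ 3.
    rewrite spray_proj rad_rho; have /= -> := rhoD (spray G) (sprayM G) (kc _).
    by rewrite SL -/Q /rho; ring.
  rewrite hor_proj // rad_rho (rhoD (dY j)) //.
  have /= -> := rhoD (hor G j) (horM G j) (kc _).
  by rewrite hL !raddfB /= SQY !dM QY k0 !der_nat /rho; ring.
move: w; rewrite rhoE sprayM horM SL' hL' !mulr0 !add0r uX.
have Su : spray G' u = \sum_i y i * dX i u.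
  by rewrite sprayE [X in _ - 2 * X]big1 ?mulr0 ?subr0 // => i _; rewrite uY mulr0.
rewrite Su dM.
have -> : dY j (\sum_i y i * dX i u) = dX j u.
  rewrite raddf_sum /=.
  have E i : dY j (y i * dX i u) = (i == j)%:R * dX i u.
    by rewrite dM dYy dC uY raddf0 mulr0 add0r mulrC eq_sym.
  by under eq_bigr do rewrite E; rewrite sum_delta.
set a := \sum_i _ => H.
have -> : dY j L' * a = (L' * dX j u + a * dY j L') - L' * dX j u by ring.
by rewrite H; ring.
Qed.

End Spray.

(** * Induced coordinates *)

Section Coordinates.
Context (R : realType) (n : nat).
Local Notation E := ('rV[R]_n * 'rV[R]_n)%type.
Implicit Types (f : E -> R) (z v : E).

Definition xcoord (i : 'I_n) (z : E) : R := z.1 0 i.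
Definition ycoord (i : 'I_n) (z : E) : R := z.2 0 i.

Lemma ycoord_linear i : linear (ycoord i).
Proof. by move=> a x y; rewrite /ycoord !mxE. Qed.

Lemma ycoord_continuous i : continuous (ycoord i).
Proof. by move=> z; apply: (@continuous_comp _ _ _ snd (fun N : 'rV[R]_n => N 0 i));
  [exact: cvg_snd|exact: coord_continuous]. Qed.

Lemma xcoord_vertical i (w : 'rV[R]_n) : xcoord i (0, w) = 0.
Proof. exact: mxE. Qed.

Lemma xy_basis v : v = \sum_i xcoord i v *: ((delta_mx 0 i, 0) : E) +
  \sum_i ycoord i v *: ((0, delta_mx 0 i) : E).
Proof.
case: v => x y; rewrite /xcoord /ycoord /=.
have mx : {morph (fun u : 'rV[R]_n => (u, 0) : E) : a b / a + b >-> a + b}.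
  by move=> a b; congr pair; rewrite /= addr0.
have my : {morph (fun u : 'rV[R]_n => (0, u) : E) : a b / a + b >-> a + b}.
  by move=> a b; congr pair; rewrite /= addr0.
have -> : (x, y) = (x, 0) + (0, y) :> E by congr pair; rewrite /= ?addr0 ?add0r.
rewrite {1}[x]row_sum_delta {1}[y]row_sum_delta.
rewrite (big_morph _ mx (erefl ((0, 0) : E))) (big_morph _ my (erefl ((0, 0) : E))).
by congr (_ + _); apply: eq_bigr => i _; congr pair; rewrite /= scaler0.
Qed.

Lemma derive_coords f z v : differentiable f z ->
  'D_v f z = \sum_i xcoord i v * dx i f z + \sum_i ycoord i v * dy i f z.
Proof.
move=> df; rewrite {1}[v]xy_basis deriveE // linearD !linear_sum.
by congr (_ + _); apply: eq_bigr => i _; rewrite linearZ /= -deriveE.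
Qed.

Section OpenSet.
Context (A : set E) (oA : open A).

Lemma smooth_ycoord i : smooth_on A (ycoord i).
Proof.
exact: (smooth_linear oA (@ycoord_linear i) (@ycoord_continuous i) (smooth_id oA)).
Qed.

End OpenSet.
End Coordinates.

Section CoordinateRing.
Context (R : realType) (n : nat).
Local Notation E := ('rV[R]_n * 'rV[R]_n)%type.
Context (A : set E) (oA : open A).
Context (T : smooth_ring A).

Definition xy_vector (s : 'I_n + 'I_n) : E :=
  match s with inl i => (delta_mx 0 i, 0) | inr i => (0, delta_mx 0 i) end.

Definition partial (s : 'I_n + 'I_n) : {additive T -> T} :=
  sderive T (xy_vector s).

Definition ysfun (i : 'I_n) : T := sfunc T (smooth_ycoord oA i).

Lemma ysfunE i w : A w -> seval w (ysfun i) = ycoord i w.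
Proof. exact: seval_sfunc. Qed.

Lemma partialM s (f g : T) :
  partial s (f * g) = f * partial s g + g * partial s f.
Proof. exact: sderiveM. Qed.

Lemma partialC s t (f : T) : partial s (partial t f) = partial t (partial s f).
Proof. exact: sderive_comm. Qed.

Lemma derive_ext (f g : E -> R) v z :
  (forall w, A w -> f w = g w) -> A z -> 'D_v f z = 'D_v g z.
Proof. by move=> fg Az; apply: near_eq_derive; apply: open_near_eq oA fg Az. Qed.

(** Ring elements and local functions agree on [A] only; as [A] is open, this is
    enough for their derivatives on [A]. *)
Lemma partial_toE s (f : E -> R) (F : T) z :
  (forall w, A w -> seval w F = f w) -> A z ->
  seval z (partial s F) = 'D_(xy_vector s) f z.
Proof.
by move=> Ff Az; rewrite -(derive_ext _ Ff Az); exact: seval_derive.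
Qed.

Lemma partial_ysfun s i : partial s (ysfun i) =
  match s with inl _ => 0 | inr j => (j == i)%:R end.
Proof.
apply: seval_inj => z Az.
rewrite (partial_toE s (ysfunE i) Az) derive_linear; first last.
- exact: ycoord_continuous.
- exact: ycoord_linear.
case: s => j; first by rewrite seval0 /ycoord mxE.
by rewrite seval_nat // /ycoord mxE eqxx eq_sym.
Qed.

Lemma partial_x_ysfun i j : partial (inl i) (ysfun j) = 0.
Proof. exact: partial_ysfun. Qed.
Lemma partial_y_ysfun i j : partial (inr i) (ysfun j) = (i == j)%:R.
Proof. exact: partial_ysfun. Qed.

Lemma radial_at (F : T) (f : E -> R) z :
  (forall w, A w -> seval w F = f w) -> smooth_on A f -> A z ->
  seval z (radial partial ysfun F) = vf_app (@liouville R n) f z.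
Proof.
move=> Ff sf Az; rewrite radialE seval_sum /vf_app.
rewrite derive_coords; last exact: smooth_differentiable sf Az.
rewrite [X in X + _]big1 => [|i _]; last by rewrite /xcoord mxE mul0r.
rewrite add0r; apply: eq_bigr => i _.
by rewrite sevalM (partial_toE _ Ff Az) ysfunE.
Qed.

Section SprayOf.
Context (S : E -> E) (S1 : forall z, A z -> (S z).1 = z.2).
Hypothesis sG : forall i, smooth_on A (spray_coef S i).

Definition Gsfun (i : 'I_n) : T := sfunc T (sG i).

Lemma GsfunE i w : A w -> seval w (Gsfun i) = spray_coef S i w.
Proof. exact: seval_sfunc. Qed.

Lemma spray_at (F : T) (f : E -> R) z :
  (forall w, A w -> seval w F = f w) -> smooth_on A f -> A z ->
  seval z (spray partial ysfun Gsfun F) = vf_app S f z.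
Proof.
move=> Ff sf Az; rewrite sprayE /vf_app.
rewrite derive_coords; last exact: smooth_differentiable sf Az.
rewrite sevalD sevalN sevalM seval_nat // !seval_sum mulr_sumr -sumrN.
congr (_ + _); apply: eq_bigr => i _.
  by rewrite sevalM (partial_toE _ Ff Az) ysfunE // /xcoord S1.
rewrite sevalM (partial_toE _ Ff Az) GsfunE // /spray_coef /ycoord /dy.
by rewrite mulrA mulrN mulNr opprK mulrA divff ?mul1r ?pnatr_eq0.
Qed.

Lemma conn_at i j w : A w ->
  seval w (conn partial Gsfun i j) = nonlin_conn S i j w.
Proof. by move=> Aw; apply: partial_toE Aw => w' Aw'; exact: GsfunE. Qed.

Lemma hor_at j (F : T) (f : E -> R) z :
  (forall w, A w -> seval w F = f w) -> A z ->
  seval z (hor partial Gsfun j F) = horiz S j f z.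
Proof.
move=> Ff Az; rewrite horE sevalD sevalN seval_sum (partial_toE _ Ff Az).
congr (_ - _); apply: eq_bigr => i _.
by rewrite sevalM (partial_toE _ Ff Az) conn_at.
Qed.

Lemma jacobi_at i j z : A z ->
  seval z (jacobi partial ysfun Gsfun i j) = jacobi_coef S i j z.
Proof.
move=> Az; rewrite /jacobi sevalD sevalD sevalN sevalM seval_nat //.
rewrite (hor_at _ (GsfunE i) Az) /jacobi_coef; congr (_ - _ + _).
  apply: spray_at Az; last exact: smooth_derive.
  by move=> w; exact: conn_at.
by rewrite seval_sum; apply: eq_bigr => k _; rewrite sevalM !conn_at.
Qed.

End SprayOf.
End CoordinateRing.

(** * The curvature of the second metric in a chart *)

Section LocalFinsler.
Context (R : realType) (n : nat).
Local Notation E := ('rV[R]_n * 'rV[R]_n)%type.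

(** The difference quotients along the radial direction are constant. *)
Lemma euler_homogeneous (f : E -> R) (z : E) :
  (forall l : R, 0 < l -> f (z.1, l *: z.2) = l * f z) ->
  vf_app (@liouville R n) f z = f z.
Proof.
move=> fh; apply: derive_near_cst; near=> h.
have h0 : h != 0 by near: h; exact: nbhs_dnbhs_neq.
have h1 : `|h| < 1 by near: h; exact: dnbhs0_lt.
have -> : h *: liouville z + z = (z.1, (1 + h) *: z.2).
  by case: z {fh} => x y; congr pair; rewrite /= ?scaler0 ?add0r // scalerDl scale1r addrC.
rewrite fh; last by rewrite -ltrBlDl sub0r; move: h1; rewrite ltr_norml => /andP[].
rewrite /GRing.scale /=; field.
exact: h0.
Unshelve. all: by end_near. Qed.

Context (A : set E) (oA : open A).

Lemma smooth_spray_coef (S : E -> E) i :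
  smooth_on A S -> smooth_on A (spray_coef S i).
Proof.
move=> sS; apply: smoothN => //; apply: smoothMl => //.
exact: (smooth_linear oA (@ycoord_linear R n i) (@ycoord_continuous R n i) sS).
Qed.

Context (T : smooth_ring A).
Local Notation yT := (ysfun oA T).
Local Notation pT := (partial T).
Local Notation pTM := (@partialM R n A T).

Lemma sfunc_sqr (f : E -> R) (F : T) :
  (forall w, A w -> seval w F = f w) ->
  forall w, A w -> seval w (F * F) = f w ^+ 2.
Proof. by move=> Ff w Aw; rewrite sevalM !Ff. Qed.

Lemma extremal_of_euler_lagrange (S : E -> E) (sG : forall i, smooth_on A (spray_coef S i))
    (F : T) (f : E -> R) :
  (forall z, A z -> (S z).1 = z.2) ->
  (forall w, A w -> seval w F = f w) -> smooth_on A f ->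
  (forall z j, A z -> vf_app S (dy j f) z = dx j f z) ->
  extremal pT yT (Gsfun T sG) F.
Proof.
move=> S1 Ff sf EL j; apply: seval_inj => z Az.
rewrite (partial_toE oA (inl j) Ff Az) -[RHS]EL //.
apply: spray_at => //; last exact: smooth_derive.
by move=> w Aw; rewrite (partial_toE oA (inr j) Ff Aw).
Qed.

Lemma radial_homogeneous1 (F : T) (f : E -> R) :
  (forall w, A w -> seval w F = f w) -> smooth_on A f ->
  (forall z, A z -> vf_app (@liouville R n) f z = f z) ->
  radial pT yT F = F.
Proof.
move=> Ff sf fh; apply: seval_inj => z Az.
by rewrite (radial_at oA Ff sf Az) fh // Ff.
Qed.

Lemma radial_sqr (F : T) : radial pT yT F = F ->
  radial pT yT (F * F) = 2 * (F * F).
Proof.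
move=> F1; rewrite radialM; last exact: pTM.
by rewrite F1; ring.
Qed.

(** On the horizontal coordinate vector d/dx^j, the left side of the geodesic equation
    is S(dL/dy^j) - y^i d^2L/dx^j dy^i, and the last sum is 2 dL/dx^j by Euler's
    relation. *)
Lemma euler_lagrange_geodesic (S : E -> E) (L : E -> R) (F : T) z j :
  (forall z, A z -> (S z).1 = z.2) ->
  (forall w, A w -> seval w F = L w) -> smooth_on A L ->
  radial pT yT F = 2 * F -> A z ->
  (forall v, ext_deriv (dJ L) z (S z) v = - diff_form L z v) ->
  vf_app S (dy j L) z = dx j L z.
Proof.
move=> S1 FL sL F2 Az /(_ (delta_mx 0 j, 0)).
have dJj : (fun w => dJ L w (delta_mx 0 j, 0)) = dy j L.
  apply/funext => w; rewrite /dJ (bigD1 j) //= big1 ?addr0 => [|i ij].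
    by rewrite mxE !eqxx mulr1.
  by rewrite mxE (negPf ij) andbF mulr0.
rewrite /ext_deriv dJj -/(vf_app S _ _) /diff_form -/(dx j L).
suff -> : 'D_(delta_mx 0 j, 0) (fun w => dJ L w (S z)) z = 2 * dx j L z.
  by move=> H; rewrite -[LHS](subrK (2 * dx j L z)) H /dx; ring.
transitivity (\sum_i (S z).1 0 i * dx j (dy i L) z).
  rewrite derive_sumE => [|i]; last first.
    apply: differentiableM; last exact: differentiable_cst.
    exact: smooth_differentiable (smooth_derive _ sL) Az.
  apply: eq_bigr => i _; under [fun w => _]funext => w do rewrite mulrC.
  rewrite derive_scaleE //.
  exact: smooth_differentiable (smooth_derive _ sL) Az.
have H := congr1 (fun f => seval z (pT (inl j) f)) F2.
rewrite /= (der_dbl pTM) sevalM seval_nat // (partial_toE oA (inl j) FL Az) in H.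
rewrite -[RHS]H radialE raddf_sum seval_sum; apply: eq_bigr => i _ /=.
rewrite partialM partial_x_ysfun mulr0 addr0 sevalM ysfunE //.
rewrite (partial_toE oA (inl j) (fun w Aw => partial_toE oA (inr i) FL Aw) Az).
by rewrite S1.
Qed.

(** The geodesic spray is the only solution of the Euler-Lagrange equation, so it
    inherits the homogeneity of F; the rank condition enters here. *)
Lemma spray_coef_homogeneous (S : E -> E) (sG : forall i, smooth_on A (spray_coef S i))
    (f : E -> R) (F : T) :
  (forall w, A w -> seval w F = f w) ->
  (forall z, A z -> \rank (metric_tensor f z) = n) ->
  radial pT yT F = F -> extremal pT yT (Gsfun T sG) (F * F) ->
  forall i, radial pT yT (Gsfun T sG i) = 2 * Gsfun T sG i.
Proof.
move=> Ff rk F1 eF; set a := fun i => radial pT yT (Gsfun T sG i) - 2 * Gsfun T sG i.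
suff a0 i : a i = 0.
  by move=> i; have /eqP := a0 i; rewrite subr_eq0 => /eqP.
apply: seval_inj => z Az; rewrite seval0.
have Ff2 := sfunc_sqr Ff.
pose r : 'rV[R]_n := \row_i seval z (a i).
suff r0 : r = 0 by have := congr1 (fun m : 'rV[R]_n => m 0 i) r0; rewrite !mxE.
have free : row_free (metric_tensor f z) by rewrite /row_free rk.
apply: (row_free_inj free); rewrite mul0mx; apply/rowP => j; rewrite !mxE.
have := radial_spray_coef pTM (partialC oA (T:=T)) (partial_x_ysfun oA T)
  (partial_y_ysfun oA T) (@sring_two_reg _ _ _ T) j (radial_sqr F1) eF.
move=> /(congr1 (seval z)); rewrite seval0 seval_sum => H.
transitivity (2^-1 * \sum_i seval z (a i * pT (inr i) (pT (inr j) (F * F)))).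
  rewrite mulr_sumr; apply: eq_bigr => k _.
  rewrite !mxE sevalM.
  rewrite (partial_toE oA (inr k) (fun w Aw => partial_toE oA (inr j) Ff2 Aw) Az).
  by rewrite mulrCA.
by rewrite H mulr0.
Qed.

Section Chart.
Variables (S Sb : E -> E) (F Fb P : E -> R) (kappa : R).
Hypotheses (sS : smooth_on A S) (sSb : smooth_on A Sb).
Hypotheses (sF : smooth_on A F) (sFb : smooth_on A Fb) (sP : smooth_on A P).
Hypothesis S1 : forall z, A z -> (S z).1 = z.2.
Hypothesis SbE : forall z, A z -> Sb z = S z - (2 * P z) *: liouville z.
Hypothesis F1 : forall z, A z -> vf_app (@liouville R n) F z = F z.
Hypothesis Fb1 : forall z, A z -> vf_app (@liouville R n) Fb z = Fb z.
Hypothesis P1 : forall z, A z -> vf_app (@liouville R n) P z = P z.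
Hypothesis Fb0 : forall z, A z -> Fb z != 0.
Hypothesis rkF : forall z, A z -> \rank (metric_tensor F z) = n.
Hypothesis geoF : forall z, A z -> forall v,
  ext_deriv (dJ (fun w => F w ^+ 2)) z (S z) v = - diff_form (fun w => F w ^+ 2) z v.
Hypothesis geoFb : forall z, A z -> forall v,
  ext_deriv (dJ (fun w => Fb w ^+ 2)) z (Sb z) v = - diff_form (fun w => Fb w ^+ 2) z v.
Hypothesis hamelP : forall z, A z -> forall v, euler_lagrange S P z v = 0.
Hypothesis curvF : forall z, A z -> forall v,
  jacobi_endo S z v = (kappa * F z ^+ 2) *: tangent_structure v
    - (kappa * F z * dJ F z v) *: liouville z.

Definition proj_curvature (z : E) : R :=
  (Fb z ^+ 2)^-1 * (kappa * F z ^+ 2 + P z ^+ 2 - vf_app S P z).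

(** The calculation may be carried out in any model [T] of the ring of smooth
    functions on [A]. *)
Theorem proj_curvature_chart :
  [/\ smooth_on A proj_curvature,
      forall z j, A z -> dy j proj_curvature z = 0,
      forall z, A z -> forall v, jacobi_endo Sb z v =
        (proj_curvature z * Fb z ^+ 2) *: tangent_structure v
        - (proj_curvature z * Fb z * dJ Fb z v) *: liouville z
    & forall z j, A z ->
        dy j (fun w => Fb w ^+ 2) z * (\sum_i ycoord i z * dx i proj_curvature z)
        = 2 * Fb z ^+ 2 * dx j proj_curvature z].
Proof.
have deltaxj (j : 'I_n) : forall i, (delta_mx 0 j : 'rV[R]_n) 0 i = (i == j)%:R.
  by move=> i; rewrite mxE eqxx.
have ELP z j : A z -> vf_app S (dy j P) z = dx j P z.
  move=> Az; have := hamelP Az (delta_mx 0 j, 0); rewrite /euler_lagrange.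
  rewrite (bigD1 j) //= big1 => [|i ij]; last by rewrite deltaxj (negPf ij) mulr0.
  by rewrite deltaxj eqxx mulr1 addr0 => /eqP; rewrite subr_eq0 => /eqP.
pose FT := sfunc T sF; pose FbT := sfunc T sFb; pose PT := sfunc T sP.
have FE w : A w -> seval w FT = F w by exact: seval_sfunc.
have FbE w : A w -> seval w FbT = Fb w by exact: seval_sfunc.
have PE w : A w -> seval w PT = P w by exact: seval_sfunc.
have FE2 := sfunc_sqr FE; have FbE2 := sfunc_sqr FbE.
have sF2 := smoothX2 oA sF; have sFb2 := smoothX2 oA sFb.
have Fb2 : forall z, A z -> Fb z ^+ 2 != 0 by move=> z Az; rewrite expf_neq0 // Fb0.
pose sG i := smooth_spray_coef i sS; pose sGb i := smooth_spray_coef i sSb.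
pose G := Gsfun T sG; pose Gb := Gsfun T sGb.
have Sb1 z : A z -> (Sb z).1 = z.2.
  by move=> Az; rewrite SbE //= scaler0 subr0 S1.
have rF := radial_homogeneous1 FE sF F1; have rF2 := radial_sqr rF.
have rFb := radial_homogeneous1 FbE sFb Fb1; have rFb2 := radial_sqr rFb.
have rP := radial_homogeneous1 PE sP P1.
have eF : extremal pT yT G (FT * FT).
  apply: (extremal_of_euler_lagrange sG S1 FE2 sF2) => z j Az.
  by apply: (euler_lagrange_geodesic j S1 FE2 sF2 rF2 Az); exact: geoF.
have eFb : extremal pT yT Gb (FbT * FbT).
  apply: (extremal_of_euler_lagrange sGb Sb1 FbE2 sFb2) => z j Az.
  by apply: (euler_lagrange_geodesic j Sb1 FbE2 sFb2 rFb2 Az); exact: geoFb.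
have eP := extremal_of_euler_lagrange sG S1 PE sP ELP.
have rG := spray_coef_homogeneous FE rkF rF eF.
have GbE : Gb = proj_coefs yT G PT.
  apply/funext => i; apply: seval_inj => z Az.
  rewrite sevalD sevalM !GsfunE // PE // ysfunE // /spray_coef SbE //.
  rewrite !mxE /ycoord.
  by rewrite /=; field.
pose KT := sfunc T (smooth_cst oA kappa).
have K0 s : pT s KT = 0.
  apply: seval_inj => z Az; rewrite (@partial_toE _ _ _ oA _ s (cst kappa)) //.
    by rewrite derive_cst seval0.
  by move=> w Aw; rewrite seval_sfunc.
have RG i j : 2 * jacobi pT yT G i j =
    KT * (2 * (FT * FT) * (i == j)%:R - yT i * pT (inr j) (FT * FT)).
  apply: seval_inj => z Az.
  rewrite !(sevalM, sevalB) !seval_nat // jacobi_at // ysfunE // seval_sfunc //.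
  rewrite (partial_toE oA (inr j) FE2 Az) !FE // /cst.
  have := congr1 (fun v : E => v.2 0 i) (curvF Az (delta_mx 0 j, 0)).
  rewrite /jacobi_endo /= !mxE /dJ.
  rewrite (bigD1 j) //= big1 => [|l lj]; last by rewrite deltaxj (negPf lj) mulr0.
  rewrite (bigD1 j) //= big1 => [|l lj]; last by rewrite deltaxj (negPf lj) mulr0.
  rewrite !deltaxj eqxx !mulr1 !addr0 => ->.
  rewrite /dy /= derive_sqrE; last exact: smooth_differentiable sF Az.
  by rewrite /ycoord; ring.
pose MT := sfunc T (smoothV oA Fb2 sFb2).
have ML : MT * (FbT * FbT) = 1.
  apply: seval_inj => z Az; rewrite sevalM seval1 // seval_sfunc // FbE2 //.
  by rewrite mulVf // Fb2.
have eFb' : extremal pT yT (proj_coefs yT G PT) (FbT * FbT).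
  by rewrite -GbE.
have [uY RGb uX] := constant_curvature_proj pTM (partialC oA (T:=T))
  (partial_x_ysfun oA T) (partial_y_ysfun oA T) (@sring_two_reg _ _ _ T)
  rG rP eP rF2 eF K0 RG rFb2 eFb' ML.
set uT := MT * _ in uY RGb uX.
have uE w : A w -> seval w uT = proj_curvature w.
  move=> Aw; rewrite sevalM sevalB sevalD sevalM !seval_sfunc // FE2 //.
  by rewrite (spray_at oA S1 sG PE sP Aw) (sfunc_sqr PE).
have su : smooth_on A proj_curvature.
  exact: (smooth_on_ext oA uE (@seval_smooth _ _ _ T uT)).
(* From here on only the values of [uT] on [A] matter, not its product form. *)
clearbody uT; split; first exact: su.
- move=> z j Az; have := congr1 (seval z) (uY j).
  by rewrite seval0 (partial_toE oA (inr j) uE Az).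
- move=> z Az v; congr pair; first by rewrite /= !scaler0 subr0.
  apply/rowP => i; rewrite !mxE.
  have RE j : jacobi_coef Sb i j z = proj_curvature z * Fb z ^+ 2 * (i == j)%:R
      - proj_curvature z * Fb z * z.2 0 i * dy j Fb z.
    have := congr1 (seval z) (RGb i j); rewrite -/G -GbE.
    rewrite !(sevalM, sevalB) !seval_nat // (jacobi_at oA T Sb1) // ysfunE //.
    rewrite (partial_toE oA (inr j) FbE2 Az) uE // !FbE //.
    rewrite /= derive_sqrE -/(dy j Fb z); last exact: smooth_differentiable sFb Az.
    move=> H; apply: (@mulfI _ 2); first by rewrite pnatr_eq0.
    by rewrite H /ycoord; ring.
  under eq_bigr => j _ do rewrite RE mulrBl.
  rewrite sumrB; congr (_ - _).
    rewrite (bigD1 i) //= eqxx mulr1 big1 ?addr0 // => j ji.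
    by rewrite eq_sym (negPf ji) mulr0 mul0r.
  rewrite [RHS]mulrAC /dJ [RHS]mulr_sumr; apply: eq_bigr => j _.
  by rewrite mulrA.
- move=> z j Az; have := congr1 (seval z) (uX j).
  rewrite !sevalM seval_sum seval_nat // (partial_toE oA (inr j) FbE2 Az) !FbE //.
  rewrite (partial_toE oA (inl j) uE Az) => <-; congr (_ * _).
  apply: eq_bigr => i _.
  by rewrite sevalM ysfunE // (partial_toE oA (inl i) uE Az).
Qed.
End Chart.
End LocalFinsler.

(** * Fibrewise and local constancy of the curvature *)

Lemma exists_orthogonal (F : fieldType) (n : nat) (a : 'I_n -> F) : (2 <= n)%N ->
  exists2 v : 'rV[F]_n, v != 0 & \sum_i v 0 i * a i = 0.
Proof.
move=> hn; have : kermx (\col_i a i) != 0.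
  rewrite -mxrank_eq0 mxrank_ker subn_eq0 -ltnNge.
  exact: leq_ltn_trans (rank_leq_col _) hn.
case/rowV0Pn => v /sub_kermxP va v0; exists v => //.
have := congr1 (fun m : 'M[F]_1 => m 0 0) va; rewrite !mxE => H; rewrite -[RHS]H.
by apply: eq_bigr => i _; rewrite mxE.
Qed.

Section BaseFunction.
Context (R : realType) (n : nat) (hn : (2 <= n)%N).
Local Notation E := ('rV[R]_n * 'rV[R]_n)%type.
Context (U : set 'rV[R]_n) (oU : open U).
Local Notation A := ([set z : E | U z.1 /\ z.2 != 0]).
Context (u : E -> R) (du : forall z, A z -> differentiable u z).
Hypothesis uY : forall z j, A z -> dy j u z = 0.

Implicit Types x y w : 'rV[R]_n.

Lemma fibre_segment x y w : U x ->
  (forall t : R, 0 <= t <= 1 -> y + t *: (w - y) != 0) -> u (x, w) = u (x, y).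
Proof.
move=> Ux yw.
have inA (t : R) : 0 <= t <= 1 -> A ((x, y) + t *: (0, w - y)).
  by move=> t01; split; rewrite /= ?scaler0 ?addr0 //; exact: yw.
have -> : (x, w) = (x, y) + (0, w - y) :> E.
  by congr pair; rewrite /= ?addr0 // addrC subrK.
apply: segment_eq => t t01; first exact: du (inA t t01).
rewrite (derive_coords _ (du (inA t t01))).
rewrite big1 => [|i _]; last by rewrite xcoord_vertical mul0r.
rewrite big1 => [|i _]; last by rewrite (uY _ (inA t t01)) mulr0.
exact: addr0.
Qed.

(** The segment from y to e_j avoids the origin because its i-th coordinate vanishes
    only at the end point e_j. *)
Lemma fibre_basis x y (i j : 'I_n) : U x -> y 0 i != 0 -> i != j ->
  u (x, delta_mx 0 j) = u (x, y).
Proof.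
move=> Ux yi ij; apply: fibre_segment => // t t01; apply/eqP => /rowP H.
have := H i; rewrite !mxE (negPf ij) andbF sub0r mulrN -[X in X - _]mul1r -mulrBl.
move=> /eqP; rewrite mulf_eq0 (negPf yi) orbF subr_eq0 => /eqP t1.
have := H j; rewrite !mxE !eqxx -t1 mul1r addrC subrK => /eqP.
by rewrite oner_eq0.
Qed.

Let i0 : 'I_n := Ordinal (ltnW hn).
Let i1 : 'I_n := Ordinal hn.

(** Two segments are enough to reach e_0; the detour over e_1 is needed when y may be
    a multiple of e_0, possibly a negative one. *)
Lemma fibre_cst_basis x y : U x -> y != 0 -> u (x, y) = u (x, delta_mx 0 i0).
Proof.
move=> Ux y0; have /existsP[i yi] : [exists i, y 0 i != 0].
  apply: contraR y0; rewrite negb_exists => /forallP y0.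
  by apply/eqP/rowP => i; rewrite mxE; apply/eqP; rewrite -[_ == _]negbK.
have [ii0|ii0] := eqVneq i i0; last by rewrite (fibre_basis Ux yi ii0).
rewrite ii0 in yi; rewrite -(@fibre_basis x y i0 i1 Ux yi) //.
rewrite -(@fibre_basis x (delta_mx 0 i1) i1 i0 Ux) //.
by rewrite mxE !eqxx oner_eq0.
Qed.

Lemma fibre_cst x y y' : U x -> y != 0 -> y' != 0 -> u (x, y) = u (x, y').
Proof. by move=> Ux y0 y0'; rewrite !fibre_cst_basis. Qed.

Lemma dx_slice x y i :
  dx i u (x, y) = 'D_(delta_mx 0 i) (fun x' => u (x', y)) x.
Proof.
rewrite /dx /derive.
have -> // : (fun h : R => h^-1 *: ((u \o shift (x, y)) (h *: (delta_mx 0 i, 0))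
    - u (x, y))) = (fun h : R => h^-1 *: (((fun x' => u (x', y)) \o shift x)
    (h *: delta_mx 0 i) - u (x, y))).
by apply/funext => h; rewrite /= /shift /GRing.add /= /add_pair /= scaler0 add0r.
Qed.

Lemma dx_fibre_cst x y y' i : U x -> y != 0 -> y' != 0 ->
  dx i u (x, y) = dx i u (x, y').
Proof.
move=> Ux y0 y0'; rewrite !dx_slice; apply: near_eq_derive.
by apply: (open_near_eq oU _ Ux) => x' Ux'; exact: fibre_cst.
Qed.

Context (L : E -> R) (b : 'I_n -> E -> R).
Hypothesis L0 : forall z, A z -> L z != 0.
Hypothesis uX : forall z j, A z ->
  b j z * (\sum_i ycoord i z * dx i u z) = 2 * L z * dx j u z.

(** Evaluate the relation at a vector y' of the same fibre for which
    y'^i du/dx^i = 0. *)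
Lemma dx_eq0 z j : A z -> dx j u z = 0.
Proof.
case: z => x y [/= Ux y0].
have [y' y'0 ay'] := exists_orthogonal (fun i => dx i u (x, y)) hn.
have Az' : A (x, y') by [].
rewrite (dx_fibre_cst j Ux y0 y'0).
have := uX j Az'; rewrite (_ : \sum_i _ = 0) ?mulr0.
  by move=> /esym/eqP; rewrite !mulf_eq0 pnatr_eq0 (negPf (L0 Az')) /= => /eqP.
by rewrite -[RHS]ay'; apply: eq_bigr => i _; rewrite (dx_fibre_cst i Ux y'0 y0).
Qed.

Lemma near_base_cst x y : U x -> y != 0 -> \forall x' \near x, u (x', y) = u (x, y).
Proof.
move=> Ux y0; have /nbhs_ballP[e /= e0 eU] : nbhs x U by exact: open_nbhs_nbhs.
apply/nbhs_ballP; exists e => //= x' xx'.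
have inA (t : R) : 0 <= t <= 1 -> A ((x, y) + t *: (x' - x, 0)).
  move=> t01; split; rewrite /= ?scaler0 ?addr0 //; apply: eU.
  move: xx'; rewrite -!ball_normE /= => xx'.
  rewrite opprD addNKr normrN normrZ; apply: le_lt_trans xx'.
  rewrite distrC -[leRHS]mul1r ler_wpM2r // ger0_norm; lra.
have -> : (x', y) = (x, y) + (x' - x, 0) :> E.
  by congr pair; rewrite /= ?addr0 // addrC subrK.
apply: segment_eq => t t01; first exact: du (inA t t01).
rewrite (derive_coords _ (du (inA t t01))).
rewrite big1 => [|i _]; last by rewrite (dx_eq0 _ (inA t t01)) mulr0.
rewrite big1 => [|i _]; last by rewrite (uY _ (inA t t01)) mulr0.
exact: addr0.
Qed.

End BaseFunction.

(** * Changes of charts on the tangent bundle *)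

Section Charts.
Context (R : realType) (n : nat) (M : smooth_manifold R n).
Local Notation E := ('rV[R]_n * 'rV[R]_n)%type.
Local Notation ch := (@mchart R n M).
Implicit Types (c : midx M) (z : E).

Lemma open_T0dom c : open (T0dom (M:=M) c).
Proof.
have o1 : open [set z : E | ccod (ch c) z.1].
  apply: (@open_comp E _ fst (ccod (ch c))); last exact: open_ccod.
  by move=> z _; exact: cvg_fst.
have o2 : open [set z : E | z.2 != 0].
  have -> : [set z : E | z.2 != 0] = snd @^-1` (~` [set 0]).
    by apply/seteqP; split=> z /eqP.
  apply: (@open_comp E _ snd); first by move=> z _; exact: cvg_snd.
  apply: closed_openC; apply: accessible_closed_set1.
  exact: hausdorff_accessible (@norm_hausdorff _ _).
exact: openI o1 o2.
Qed.

Lemma near_fst (U : set 'rV[R]_n) (z : E) : open U -> U z.1 ->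
  \forall w \near z, U w.1.
Proof.
move=> oU Uz; have := @cvg_fst _ _ (nbhs z.1) (nbhs z.2) _ U.
by apply; exact: open_nbhs_nbhs.
Qed.

(** Linearity in the second argument turns (x, y) |-> D_y f(x) into a sum of products
    of coordinates with derivatives in fixed directions. *)
Lemma differentiable_direction (U : set 'rV[R]_n) (f : 'rV[R]_n -> 'rV[R]_n) z :
  open U -> smooth_on U f -> U z.1 ->
  differentiable (fun w : E => 'D_(w.2) f w.1) z.
Proof.
move=> oU sf Uz.
pose h i j (w : E) : R := (w.2 0 i) * ('D_(delta_mx 0 i) f w.1) 0 j.
have dfst : differentiable (@fst 'rV[R]_n 'rV[R]_n : E -> _) z.
  by apply: differentiable_linear => // w; exact: cvg_fst.
have dh i j : differentiable (h i j) z.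
  apply: differentiableM.
    exact: differentiable_linear (@ycoord_linear R n i) (@ycoord_continuous R n i) z.
  apply: (@differentiable_comp _ _ _ _ (fun w : E => 'D_(delta_mx 0 i) f w.1)
    (fun v : 'rV[R]_n => v 0 j)); last exact: differentiable_coord.
  apply: (@differentiable_comp _ _ _ _ (@fst _ _) ('D_(delta_mx 0 i) f)) => //.
  exact: smooth_differentiable (smooth_derive _ sf) Uz.
apply: (@near_eq_differentiable _ _ _
  (\sum_i \sum_j (fun w => h i j w *: (delta_mx 0 j : 'rV[R]_n)))); last first.
  apply: differentiable_sum => i; apply: differentiable_sum => j.
  exact: differentiableZl.
apply: filterS (near_fst oU Uz) => w Uw.
rewrite fct_sumE /h; under eq_bigr do rewrite fct_sumE.
have df : differentiable f w.1 by exact: smooth_differentiable sf Uw.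
rewrite [in RHS](row_sum_delta w.2) deriveE // linear_sum.
apply: eq_bigr => i _; rewrite linearZ /= -deriveE //.
rewrite [in RHS](row_sum_delta ('D_(delta_mx 0 i) f w.1)) scaler_sumr.
by apply: eq_bigr => j _; rewrite scalerA.
Qed.

Lemma open_overlap c c' :
  open (ccod (ch c) `&` cinv (ch c) @^-1` cdom (ch c')).
Proof. by rewrite openE => x [cx c'x]; exact: near_chart_trans. Qed.

Lemma tangent_transE c c' z :
  ccod (ch c) z.1 -> cdom (ch c') (cinv (ch c) z.1) ->
  tangent_trans c c' z = (chart_trans (ch c) (ch c') z.1,
                          'D_(z.2) (chart_trans (ch c) (ch c')) z.1).
Proof.
move=> cz c'z; rewrite /tangent_trans /coords /=; congr pair.
by rewrite /of_coords_comp; case: asboolP => // -[].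
Qed.

Lemma differentiable_tangent_trans c c' z :
  ccod (ch c) z.1 -> cdom (ch c') (cinv (ch c) z.1) ->
  differentiable (tangent_trans c c') z.
Proof.
move=> cz c'z; have oU := @open_overlap c c'.
have sU := mchart_smooth c c'.
have Uz : (ccod (ch c) `&` cinv (ch c) @^-1` cdom (ch c')) z.1 by [].
apply: (@near_eq_differentiable _ _ _ (fun w : E =>
  (chart_trans (ch c) (ch c') w.1, 'D_(w.2) (chart_trans (ch c) (ch c')) w.1))).
  by apply: filterS (near_fst oU Uz) => w [cw c'w]; rewrite tangent_transE.
apply: differentiable_pair; last exact: differentiable_direction oU sU Uz.
apply: (@differentiable_comp _ _ _ _ (@fst _ _) (chart_trans (ch c) (ch c'))).
  by apply: differentiable_linear => // w; exact: cvg_fst.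
exact: chart_trans_diff.
Qed.

Lemma local_tangent_trans (f : tangent_bundle M -> R) c c' z :
  cdom (ch c') (cinv (ch c) z.1) -> local f c' (tangent_trans c c' z) = local f c z.
Proof. by move=> c'z; rewrite /local /tangent_trans /= coordsK. Qed.

(** The inverse change of charts is linear on the fibre and would map a zero vector
    to zero. *)
Lemma tangent_trans_T0dom c c' z : T0dom c z ->
  cdom (ch c') (cinv (ch c) z.1) -> T0dom c' (tangent_trans c c' z).
Proof.
move=> [cz z0] c'z; split; first exact: cmap_ccod.
apply: contra_neq z0 => /= t0.
have cK := of_coordsK (z := z) cz.
rewrite -[z.2]/((z.1, z.2).2) -surjective_pairing -cK /=.
have := @tcomp_trans _ _ _ (of_coords c z) c' c c'z (cinv_cdom cz).
by move=> /= ->; rewrite t0 derive0.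
Qed.

(** The derivative of a function along a vector field does not depend on the chart:
    this is the chain rule for the transition map of the tangent bundle. *)
Lemma vf_app_tangent_trans (X : T0_vector_field M) (f : tangent_bundle M -> R) c c' z :
  smooth_T0 f -> T0dom c z -> cdom (ch c') (cinv (ch c) z.1) ->
  vf_app (X c') (local f c') (tangent_trans c c' z) = vf_app (X c) (local f c) z.
Proof.
move=> sf Tz c'z; rewrite /vf_app vf_trans //.
have df : differentiable (local f c') (tangent_trans c c' z).
  exact: smooth_differentiable (sf c') (tangent_trans_T0dom Tz c'z).
have dt := differentiable_tangent_trans (proj1 Tz) c'z.
transitivity ('D_(X c z) (local f c' \o tangent_trans c c') z).
  exact/esym/derive_chain.
apply: near_eq_derive.
have Uz : (ccod (ch c) `&` cinv (ch c) @^-1` cdom (ch c')) z.1 by case: Tz.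
by apply: filterS (near_fst (@open_overlap c c') Uz) => w [cw c'w]; exact: local_tangent_trans.
Qed.

End Charts.

(** * Constancy on a connected manifold *)

Lemma locally_constant_connected (T : topologicalType) (X : Type) (k : T -> X) :
  connected [set: T] -> (forall p, \forall q \near p, k q = k p) ->
  forall p q, k p = k q.
Proof.
move=> cT kloc p q; pose B := [set r | k r = k q].
suff BT : B = [set: T] by have : B p by rewrite BT.
have oB : open B by rewrite openE => r kr; apply: filterS (kloc r) => s sr; rewrite /B /= sr.
apply: cT; first by exists q.
  by exists B; rewrite ?setTI.
exists B; rewrite ?setTI // -[B]setCK; apply: open_closedC.
by rewrite openE => r nr; apply: filterS (kloc r) => s sr; rewrite /B /= sr.
Qed.

Theorem proposition3p5 (R : realType) (n : nat) (hn : (2 <= n)%N)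
  (M : smooth_manifold R n) (hM : connected [set: M])
  (F Fbar : tangent_bundle M -> R) (hF : finsler F) (hFbar : finsler Fbar)
  (S Sbar : T0_vector_field M)
  (hS : geodesic_spray F S) (hSbar : geodesic_spray Fbar Sbar)
  (P : tangent_bundle M -> R) (hP : projectively_related S Sbar P)
  (hcurv : constant_flag_curvature F S) (hhamel : hamel S P) :
  constant_flag_curvature Fbar Sbar.
Proof.
have [_ sF Fpos Fhom Frk] := hF; have [_ sFb Fbpos Fbhom _] := hFbar.
have [sP P1 SbE] := hP; have [kappa RF] := hcurv; have [_ ELP] := hhamel.
pose u c := proj_curvature (S c) (local F c) (local Fbar c) (local P c) kappa.
have Fb0 c z : T0dom c z -> local Fbar c z != 0 by move=> /Fbpos; case: ltgtP.
have euler (f : tangent_bundle M -> R) c z : (forall c z (l : R), Tdom c z -> 0 < l ->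
      local f c (z.1, l *: z.2) = l * local f c z) -> T0dom c z ->
    vf_app (@liouville R n) (local f c) z = local f c z.
  by move=> fh [cz _]; apply: euler_homogeneous => l l0; exact: fh.
have oT c : open (T0dom (M:=M) c) by exact: open_T0dom.
have sS (X : T0_vector_field M) c : smooth_on (T0dom c) (X c) by exact: vf_smooth.
have chartP c := proj_curvature_chart (oT c) (smooth_ring_of (oT c)) (sS S c) (sS Sbar c)
  (sF c) (sFb c) (sP c) (fun z Tz => (hS c z Tz).1) (SbE c)
  (fun z => euler F c z Fhom) (fun z => euler Fbar c z Fbhom) (P1 c)
  (Fb0 c) (Frk c) (fun z Tz => (hS c z Tz).2) (fun z Tz => (hSbar c z Tz).2)
  (ELP c) (RF c).
have ufib c x y y' : ccod (mchart c) x -> y != 0 -> y' != 0 -> u c (x, y) = u c (x, y').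
  have [su uY _ _] := chartP c.
  apply: (fibre_cst hn (U := ccod (mchart c))) => [z Az|z j Az].
    exact: smooth_differentiable su Az.
  exact: uY.
have unear c x y : ccod (mchart c) x -> y != 0 ->
    \forall x' \near x, u c (x', y) = u c (x, y).
  have [su uY _ uX] := chartP c.
  have Fb20 z : T0dom c z -> local Fbar c z ^+ 2 != 0.
    by move=> Tz; rewrite expf_neq0 // Fb0.
  exact: (@near_base_cst R n hn _ (@open_ccod _ _ _ (mchart c)) (u c)
    (fun z => smooth_differentiable su) uY (fun w => local Fbar c w ^+ 2)
    (fun j => dy j (fun w => local Fbar c w ^+ 2)) Fb20 uX).
have utrans c c' z : T0dom c z -> cdom (mchart c') (cinv (mchart c) z.1) ->
    u c' (tangent_trans c c' z) = u c z.
  move=> Tz c'z; rewrite /u /proj_curvature !local_tangent_trans //.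
  by rewrite vf_app_tangent_trans.
pose e : 'rV[R]_n := delta_mx 0 (Ordinal hn).
have e0 : e != 0.
  by apply/eqP => /rowP/(_ (Ordinal hn))/eqP; rewrite !mxE !eqxx oner_eq0.
pose cp (p : M) : midx M := sval (cid (mchart_cover p)).
have cpP (p : M) : cdom (mchart (cp p)) p := svalP (cid (mchart_cover p)).
(* The flag curvature as a function on M, computed in a chosen chart and on a fixed
   nonzero vector; [kE] shows that neither choice matters. *)
pose k (p : M) : R := u (cp p) (cmap (mchart (cp p)) p, e).
have kE c p y : cdom (mchart c) p -> y != 0 -> k p = u c (cmap (mchart c) p, y).
  move=> cpp y0; pose z := (cmap (mchart (cp p)) p, e).
  have Tz : T0dom (cp p) z by split => //; apply: cmap_ccod.
  have zp : cinv (mchart (cp p)) z.1 = p by rewrite /= cmapK.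
  have c'z : cdom (mchart c) (cinv (mchart (cp p)) z.1) by rewrite zp.
  rewrite /k -/z -(utrans _ _ _ Tz c'z).
  have [_ t0] := tangent_trans_T0dom Tz c'z.
  have -> : tangent_trans (cp p) c z =
      (cmap (mchart c) p, (tangent_trans (cp p) c z).2).
    by rewrite {1}[tangent_trans _ _ _]surjective_pairing /= zp.
  by apply: ufib => //; exact: cmap_ccod.
have kloc p : \forall q \near p, k q = k p.
  have cpp := cpP p; set c := cp p in cpp.
  have near1 : \forall q \near p, cdom (mchart c) q.
    by apply: open_nbhs_nbhs; split => //; exact: open_cdom.
  have near2 : \forall q \near p, u c (cmap (mchart c) q, e) = u c (cmap (mchart c) p, e).
    exact: (cmap_continuous cpp (unear c _ _ (cmap_ccod cpp) e0)).
  by apply: filterS2 near1 near2 => q cq uq; rewrite (kE c q e) // (kE c p e).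
have kcst := locally_constant_connected hM kloc.
have [[p0 _]|nop] := pselect (exists p : M, True); last first.
  by exists 0 => c z _; case: nop; exists (cinv (mchart c) z.1).
exists (k p0) => c z Tz v; have [_ _ RFb _] := chartP c; rewrite (RFb z Tz v).
rewrite -/(u c z) (kcst p0 (cinv (mchart c) z.1)).
have [cz z0] := Tz.
by rewrite (kE c _ z.2) ?cinvK -?surjective_pairing //; exact: cinv_cdom.
Qed.
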